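(* Let $G$ be a contact Carnot group and $p=(x,z)\in G$ with $p\ne p_0$. The set $\Gamma_0(p)$ is finite, and $\Gamma_\infty(p)$ is a closed set homeomorphic to the disjoint union of spheres $$\Gamma_\infty(p)\simeq\bigcup_{\lambda\in\Lambda_p}S^{2N(\lambda)-1},\qquad N(\lambda)=\sum_{j\in L(\lambda)}n_j,$$ where $$\Lambda_p=\Big\{\lambda\in\Lambda\ \Big|\ \Big(z-\sum_{j\notin I_0}\alpha_jg(\lambda\alpha_j)\|x_j\|^2\Big)\lambda>0\Big\}.$$ Moreover the energy function $J$ is constant on each component of $\Gamma(p)$.
   Context: A contact Carnot group $G$ is a connected, simply connected Lie group of dimension $2n+1$ whose Lie algebra of left-invariant vector fields splits as $\mathfrak g=\mathfrak g_1\oplus\mathfrak g_2$ with $\dim\mathfrak g_2=1$, $[\mathfrak g_1,\mathfrak g_1]=\mathfrak g_2$, $[\mathfrak g_1,\mathfrak g_2]=[\mathfrak g_2,\mathfrak g_2]=0$, with a scalar product on $\mathfrak g_1$ having orthonormal basis $f_1,\dots,f_{2n}$. Fix a generator $f_0$ of $\mathfrak g_2$; then $[f_i,f_j]=A_{ij}f_0$ for a skew-symmetric non-degenerate matrix $A$. Exponential coordinates: $p=(x,z)\in\mathbb{R}^{2n}\times\mathbb{R}$ means $p=\exp_G(\sum_i x_if_i+zf_0)$; $p_0=(0,0)$. Let $0<\alpha_1<\dots<\alpha_k$ be the distinct singular values of $A$ with multiplicities $n_j$ (the associated invariant subspace has dimension $2n_j$) and $x_j\in\mathbb{R}^{2n_j}$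 the projection of $x$ on the invariant subspace associated with $\alpha_j$. A geodesic is a non-constant Lipschitz curve $\gamma:[0,1]\to G$, tangent a.e. to $\mathfrak g_1$, locally minimizing the energy $J(\gamma)=\frac12\int_0^1\|\dot\gamma\|^2dt$. With $H(\eta)=\frac12\sum_i\langle\eta,f_i\rangle^2$ on $T^*G$, the exponential map is $\hat E(\eta)=\pi(e^{\vec H}(\eta))$, $\eta\in T_{p_0}^*G$ (the geodesic with initial covector $\eta$ being $t\mapsto\pi(e^{t\vec H}(\eta))$, and $J$ being evaluated on it), and $\Gamma(p)=\hat E^{-1}(p)$ with the subspace topology is the set of geodesics from $p_0$ to $p$. Write $\eta=(u_1,\dots,u_k,\lambda)$, where $u=(\langle\eta,f_i\rangle)_i\in\mathbb{R}^{2n}$, $u_j\in\mathbb{R}^{2n_j}$ is its projection on the invariant subspace of $\alpha_j$, and $\lambda=\langle\eta,f_0\rangle$. Put $I_0=\{j\mid x_j=0\}$, $\Gamma_0(p)=\{(u,\lambda)\in\Gamma(p)\mid\sum_{j\in I_0}\|u_j\|^2=0\}$ and $\Gamma_\infty(p)=\Gamma(p)\setminus\Gamma_0(p)$. Define $g(\lambda)=\frac18\frac{\lambda-\sin\lambda}{(\sin\frac\lambda2)^2}$ (with $g(0)=0$; $g$ is odd, with poles on $2\pi\mathbb{Z}\setminus\{0\}$, where it is given the value $+\infty$ for $\lambda>0$ and $-\infty$ for $\lambda<0$; thus $\lambda\notin\Lambda_p$ if $\lambda\alpha_j$ is a pole of $g$ for some $j\notin I_0$), $\Lambda_j=\frac{2\pi}{\alpha_j}\mathbb{Z}\setminus\{0\}$,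 $\Lambda=\bigcup_{j=1}^k\Lambda_j$, $L(\lambda)=\{j\mid\lambda\in\Lambda_j\}$. *)

(* Defs.v *)
From HB Require Import structures.
From mathcomp Require Import all_boot all_order all_algebra.
From mathcomp Require Import all_classical all_reals all_analysis.

Set Implicit Arguments.
Unset Strict Implicit.
Unset Printing Implicit Defensive.

Import Order.TTheory GRing.Theory Num.Theory.
Import numFieldNormedType.Exports.

Local Open Scope classical_set_scope.
Local Open Scope ring_scope.

(* A contact Carnot group is given by its Lie algebra [cc_alg]: a connected,
   simply connected nilpotent Lie group is determined by its Lie algebra, and
   the exponential identifies it with that algebra (see [bch]). *)
Record contact_carnot (R : realType) (n : nat) := ContactCarnot {
  cc_alg :> vectType R;
  cc_br : cc_alg -> cc_alg -> cc_alg;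
  cc_br_linearl : forall (a : R) (u v w : cc_alg),
    cc_br (a *: u + v) w = a *: cc_br u w + cc_br v w;
  cc_br_linearr : forall (a : R) (u v w : cc_alg),
    cc_br w (a *: u + v) = a *: cc_br w u + cc_br w v;
  cc_br_alternating : forall u, cc_br u u = 0;
  cc_br_jacobi : forall u v w,
    cc_br u (cc_br v w) + cc_br v (cc_br w u) + cc_br w (cc_br u v) = 0;
  cc_g1 : {vspace cc_alg};
  cc_g2 : {vspace cc_alg};
  cc_dim : \dim (fullv : {vspace cc_alg}) = n.*2.+1;
  cc_split : (cc_g1 + cc_g2)%VS = fullv;
  cc_direct : directv (cc_g1 + cc_g2);
  cc_dim2 : \dim cc_g2 = 1;
  (* [g1, g1] is spanned by the brackets of the elements of a basis *)
  cc_br11 :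
    <<[seq cc_br u v | u <- vbasis cc_g1, v <- vbasis cc_g1]>>%VS = cc_g2;
  cc_br12 : forall u v, u \in cc_g1 -> v \in cc_g2 -> cc_br u v = 0;
  cc_br22 : forall u v, u \in cc_g2 -> v \in cc_g2 -> cc_br u v = 0;
  (* the contact condition, i.e., non-degeneracy of the matrix [bracket_mx] *)
  cc_contact : forall u, u \in cc_g1 ->
    (forall v, v \in cc_g1 -> cc_br u v = 0) -> u = 0;
  (* the scalar product is meaningful on g1 only *)
  cc_dot : cc_alg -> cc_alg -> R;
  cc_dot_linear : forall (a : R) (u v w : cc_alg),
    u \in cc_g1 -> v \in cc_g1 -> w \in cc_g1 ->
    cc_dot (a *: u + v) w = a * cc_dot u w + cc_dot v w;
  cc_dot_sym : forall u v, u \in cc_g1 -> v \in cc_g1 ->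
    cc_dot u v = cc_dot v u;
  cc_dot_pos : forall u, u \in cc_g1 -> u != 0 -> 0 < cc_dot u u
}.

Record adapted_frame (R : realType) (n : nat) (G : contact_carnot R n) :=
  AdaptedFrame {
  frame1 : (n.*2).-tuple G;
  frame0 : G;
  frame1_basis : basis_of (cc_g1 G) frame1;
  frame1_orthonormal : forall i j : 'I_(n.*2),
    cc_dot (tnth frame1 i) (tnth frame1 j) = (i == j)%:R;
  frame0_gen : <[frame0]>%VS = cc_g2 G
}.

(* Coordinates (x, z) of points, tangent vectors and covectors. *)
Notation coords R n := ('rV[R]_(n.*2) * R)%type.

Section Euclidean.
Context {R : realType}.

Definition sqnorm (d : nat) (v : 'rV[R]_d) : R := \sum_(i < d) v 0 i ^+ 2.

Definition unit_sphere (d : nat) : set 'rV[R]_d := [set v | sqnorm v = 1].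

Definition homeomorphic (X Y : topologicalType) : Prop :=
  exists (f : X -> Y) (g : Y -> X),
    [/\ cancel f g, cancel g f, continuous f & continuous g].

End Euclidean.
Arguments unit_sphere : clear implicits.

Section CarnotGroup.
Context {R : realType} {n : nat} {G : contact_carnot R n}.
Variable F : adapted_frame G.

Let full_frame : (n.*2).+1.-tuple G := [tuple of frame0 F :: frame1 F].

Definition exp_coords (p : coords R n) : G :=
  \sum_(i < n.*2) p.1 0 i *: tnth (frame1 F) i + p.2 *: frame0 F.

Definition log_coords (w : G) : coords R n :=
  (\row_i coord full_frame (lift ord0 i) w, coord full_frame ord0 w).

(* The Baker-Campbell-Hausdorff product; all brackets of order at least three
   vanish, so exp u * exp v = exp (bch u v). *)
Definition bch (u v : G) : G := u + v + 2^-1 *: cc_br u v.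

Definition group_mul (p q : coords R n) : coords R n :=
  log_coords (bch (exp_coords p) (exp_coords q)).

(* [f_i, f_j] = bracket_mx i j *: f_0 *)
Definition bracket_mx : 'M[R]_(n.*2) :=
  \matrix_(i, j)
    coord full_frame ord0 (cc_br (tnth (frame1 F) i) (tnth (frame1 F) j)).

(* The left-invariant vector field equal to w at the identity, evaluated at p:
   the velocity at t = 0 of t |-> p * exp (t w). *)
Definition left_invariant (w p : coords R n) : coords R n :=
  derive1 (fun t : R => group_mul p (t *: w)) 0.

Definition frame_field (i : 'I_(n.*2)) : coords R n -> coords R n :=
  left_invariant (delta_mx 0 i, 0).

Definition pairing (eta v : coords R n) : R :=
  \sum_(i < n.*2) eta.1 0 i * v.1 0 i + eta.2 * v.2.

(* A point of the cotangent bundle is a pair (q, eta) with q in G and eta the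
   covector \sum_i eta.1 0 i dx_i + eta.2 dz at q. *)
Definition hamiltonian (s : coords R n * coords R n) : R :=
  2^-1 * \sum_(i < n.*2) pairing s.2 (frame_field i s.1) ^+ 2.

Definition gradient (h : coords R n -> R) (v : coords R n) : coords R n :=
  (\row_i derive h v (delta_mx 0 i, 0), derive h v (0, 1)).

Definition hamiltonian_field (s : coords R n * coords R n) :
    coords R n * coords R n :=
  (gradient (fun eta => hamiltonian (s.1, eta)) s.2,
   - gradient (fun q => hamiltonian (q, s.2)) s.1).

Definition hamiltonian_curve (c : R -> coords R n * coords R n) : Prop :=
  forall t : R, is_derive t 1 c (hamiltonian_field (c t)).

(* The integral curve t |-> e^(t H) (eta) issued from the covector eta at the
   identity (0, 0). As the frame fields are the coordinate fields at (0, 0),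
   eta = (u, lambda) with u_i = <eta, f_i> and lambda = <eta, f_0>. *)
Definition lift_of (eta : coords R n) : R -> coords R n * coords R n :=
  xget (fun=> 0) [set c | hamiltonian_curve c /\ c 0 = (0, eta)].

Definition geodesic (eta : coords R n) : R -> coords R n :=
  fun t => (lift_of eta t).1.

Definition exponential_map (eta : coords R n) : coords R n := geodesic eta 1.

Definition Gamma (p : coords R n) : set (coords R n) :=
  [set eta | exponential_map eta = p].

(* A horizontal velocity \sum_i v_i f_i has x-coordinates v, and the f_i are
   orthonormal, so that its squared norm is the Euclidean one of v. *)
Definition energy (gamma : R -> coords R n) : R :=
  2^-1 * Rintegral lebesgue_measure `[0, 1]
           (fun t => sqnorm (derive1 gamma t).1).

Definition J (eta : coords R n) : R := energy (geodesic eta).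

End CarnotGroup.

Section SingularValues.
Context {R : realType} {d : nat}.
Variable A : 'M[R]_d.

Definition singular_value (a : R) : Prop :=
  0 <= a /\ eigenvalue (A^T *m A) (a ^+ 2).

Definition invariant_space (a : R) : 'M[R]_d := eigenspace (A^T *m A) (a ^+ 2).

(* Orthogonal projection: the rows of kermx V^T span the orthogonal complement
   of the row space of V. *)
Definition orth_proj (V : 'M[R]_d) (x : 'rV[R]_d) : 'rV[R]_d :=
  x *m proj_mx V (kermx V^T).

Record distinct_singular_values (k : nat) (alpha : 'I_k -> R)
    (m : 'I_k -> nat) : Prop := {
  dsv_pos : forall j, 0 < alpha j;
  dsv_increasing : forall i j : 'I_k, (i < j)%N -> alpha i < alpha j;
  dsv_values : forall a, singular_value a <-> exists j, alpha j = a;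
  dsv_mult : forall j, \rank (invariant_space (alpha j)) = (m j).*2
}.

End SingularValues.

Section Topology.
Context {R : realType} {n : nat} {G : contact_carnot R n}.
Variables (F : adapted_frame G) (k : nat) (alpha : 'I_k -> R) (m : 'I_k -> nat).

Definition component_of (j : 'I_k) (x : 'rV[R]_(n.*2)) : 'rV[R]_(n.*2) :=
  orth_proj (invariant_space (bracket_mx F) (alpha j)) x.

Definition I0 (x : 'rV[R]_(n.*2)) : {pred 'I_k} :=
  [pred j | component_of j x == 0].

Definition Gamma0 (p : coords R n) : set (coords R n) :=
  [set eta | Gamma F p eta /\
    \sum_(j in I0 p.1) sqnorm (component_of j eta.1) = 0].

Definition Gamma_inf (p : coords R n) : set (coords R n) :=
  Gamma F p `\` Gamma0 p.

Definition g (l : R) : \bar R :=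
  if l == 0 then 0%E
  else if sin (l / 2) == 0 then (if 0 < l then +oo%E else -oo%E)
  else (8^-1 * ((l - sin l) / sin (l / 2) ^+ 2))%:E.

Definition Lambda_ (j : 'I_k) : set R :=
  [set l | l != 0 /\ exists q : int, l = 2 * pi / alpha j * q%:~R].

Definition Lambda : set R := \bigcup_j Lambda_ j.

Definition L (l : R) : {pred 'I_k} := [pred j | l \in Lambda_ j].

Definition N (l : R) : nat := (\sum_(j in L l) m j)%N.

Definition Lambda_p (p : coords R n) : set R :=
  [set l | Lambda l /\
    (0 < (p.2%:E - \sum_(j < k | j \notin I0 p.1)
           (alpha j)%:E * g (l * alpha j)
             * (sqnorm (component_of j p.1))%:E) * l%:E)%E].

(* S^(2 N - 1) is the unit sphere of R^(2 N). *)
Definition spheres (p : coords R n) : topologicalType :=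
  {l : Lambda_p p & unit_sphere R (N (set_val l)).*2}.

End Topology.

(* Main.v *)
Require Import Defs.
From HB Require Import structures.
From mathcomp Require Import all_boot all_order all_algebra finmap.
From mathcomp Require Import complex.
From mathcomp Require Import all_classical all_reals all_analysis.
From mathcomp Require Import ring lra.

(* The Hamiltonian flow is explicit. With h the vector of momenta <eta, f_i> and
   A the bracket matrix, lambda is constant, h' = lambda h A, x' = h and
   z' = (xA).h / 2. The symmetric matrix A^T A splits R^(2n) orthogonally into
   the invariant subspaces of the alpha_j, on each of which A / alpha_j is a
   complex structure, so that the flow multiplies u_j by e^(i w_j t), where
   w_j = lambda alpha_j. At time 1 this gives
   x_j = sin(w_j / 2) / (w_j / 2) e^(i w_j / 2) u_j, and u_j contributes
   |u_j|^2 (w_j - sin w_j) / (2 lambda w_j) to z.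

   For lambda <> 0 the equation E(u, lambda) = (x, z) thus says: x_j = 0 for
   j in L(lambda); u_j is determined by x_j for the other j, and its
   contribution to z is then alpha_j g(w_j) |x_j|^2; the remaining components
   satisfy sum_(j in L(lambda)) |u_j|^2 =
   2 lambda (z - sum_(j notin I_0) alpha_j g(w_j) |x_j|^2).
   The last equation is a sphere when its right-hand side is positive, and
   Lambda is closed and discrete, which describes Gamma_inf. On Gamma_0 the
   right-hand side vanishes. As a function of lambda > 0 the sum is strictly
   convex away from its poles, by the Cusa-Huygens inequality
   3 sin w < w (2 + cos w), and grows at least linearly, so the solutions are
   bounded and cannot accumulate. Finally |u|^2 is determined by lambda on
   Gamma(p), and lambda takes its values in a closed discrete set there, hence
   is constant on connected components. *)

Set Implicit Arguments.
Unset Strict Implicit.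
Unset Printing Implicit Defensive.

Import Order.TTheory GRing.Theory Num.Theory.
Import numFieldNormedType.Exports.

Local Open Scope classical_set_scope.
Local Open Scope ring_scope.

(** * Closed discrete sets and slices of a product *)

Section ClosedDiscrete.
Context {T : topologicalType}.
Implicit Types (C D : set T) (x y : T).

(* x is not required to be in D, so D has no accumulation point at all. *)
Definition closed_discrete D := forall x, \forall y \near x, D y -> y = x.

Lemma sub_closed_discrete C D :
  C `<=` D -> closed_discrete D -> closed_discrete C.
Proof. by move=> CD discD x; apply: filterS (discD x) => y yx /CD. Qed.

Lemma closed_discreteU C D :
  closed_discrete C -> closed_discrete D -> closed_discrete (C `|` D).
Proof.
move=> discC discD x; apply: filterS2 (discC x) (discD x) => y yC yD [].
  exact: yC.
exact: yD.
Qed.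

Lemma closed_discrete_bigcup (I : finType) (D : I -> set T) :
  (forall i, closed_discrete (D i)) -> closed_discrete (\bigcup_i D i).
Proof.
move=> discD x.
have : \forall y \near x, forall i, D i y -> y = x.
  by apply: filter_forall => i; exact: discD.
by apply: filterS => y yx [i _]; exact: yx.
Qed.

Lemma finite_closed_discrete D :
  accessible_space T -> finite_set D -> closed_discrete D.
Proof.
move=> T1 finD x; have /closed_openC : closed (D `\ x).
  by move/accessible_finite_set_closed : T1; apply; exact: finite_setD.
move=> openD; have : nbhs x (~` (D `\ x)).
  by apply: open_nbhs_nbhs; split=> // -[_]; exact.
by apply: filterS => y yD Dy; apply: contrapT => yx; exact: yD.
Qed.

Lemma connected_closed_discrete C D x y : accessible_space T ->
  closed_discrete D -> C `<=` D -> connected C -> C x -> C y -> x = y.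
Proof.
move=> T1 discD CD connC Cx Cy.
pose U := interior [set z | D z -> z = x].
have CU : [set x] = C `&` U.
  apply/seteqP; split=> [z ->|z [Cz /nbhs_singleton]]; last by apply; exact: CD.
  by split=> //; exact: discD.
have Cclosed : [set x] = C `&` [set x] by rewrite setIidr// => z ->.
have CE : [set x] = C.
  apply: connC; first by exists x.
    by exists U => //; exact: open_interior.
  by exists [set x] => //; exact: accessible_closed_set1.
by apply/esym; change ([set x] y); rewrite CE.
Qed.

End ClosedDiscrete.

Lemma separated_closed_discrete (R : realFieldType) (D : set R) (e : R) :
  0 < e -> (forall x y, D x -> D y -> `|x - y| < e -> x = y) ->
  closed_discrete D.
Proof.
move=> e0 sepD x; have [Dx|nDx] := pselect (D x).
  by apply/nbhs_ballP; exists e => // y xy Dy; apply: sepD; rewrite // distrC.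
have [[a [Da xa]]|no_a] := pselect (exists a, D a /\ ball x (e / 2) a).
  have ax : a != x by apply: contra_notN nDx => /eqP <-.
  apply/nbhs_ballP; exists `|a - x|; first by rewrite /= normr_gt0 subr_eq0.
  move=> y xy Dy; exfalso; suff ya : y = a.
    by move: xy; rewrite ya /ball/= distrC ltxx.
  apply: sepD => //; have := ler_distD x y a.
  move: xy xa; rewrite /ball/= (distrC x y) (distrC a x); lra.
apply/nbhs_ballP; exists (e / 2); first by rewrite /= divr_gt0.
by move=> y xy Dy; case: no_a; exists y.
Qed.

Lemma homeomorphic_sets (V W : topologicalType) (A : set V) (B : set W)
    (f : V -> W) (g : W -> V) :
  (forall x, A x -> B (f x)) -> (forall y, B y -> A (g y)) ->
  {in A, cancel f g} -> {in B, cancel g f} ->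
  {in A, continuous f} -> {in B, continuous g} -> homeomorphic A B.
Proof.
move=> AB BA fK gK contf contg.
pose F (x : A) : B := exist _ (f (set_val x)) (mem_set (AB _ (set_valP x))).
pose G (y : B) : A := exist _ (g (set_val y)) (mem_set (BA _ (set_valP y))).
exists F, G; split.
- by move=> x; apply: val_inj; apply: fK; exact: mem_set (set_valP x).
- by move=> y; apply: val_inj; apply: gK; exact: mem_set (set_valP y).
- apply: continuous_comp_initial.
  exact/subspace_sigL_continuousP/continuous_in_subspaceT.
- apply: continuous_comp_initial.
  exact/subspace_sigL_continuousP/continuous_in_subspaceT.
Qed.

Section Slices.
Context {V I : topologicalType} (S : set (V * I)) (D : set I).
Hypothesis D_discrete : closed_discrete D.
Hypothesis S_over_D : forall v, S v -> D v.2.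

Lemma closed_slices : (forall i, closed [set u | S (u, i)]) -> closed S.
Proof.
move=> closedS [u i] clS; apply: (closedS i) => B Bu.
have nbhs_ui : nbhs (u, i) (B `*` [set j | D j -> j = i]).
  by exists (B, [set j | D j -> j = i]) => //; split=> //; exact: D_discrete.
have [[v j] [Sv /= [Bv ji]]] := clS _ nbhs_ui.
by exists v; split=> //=; rewrite -(ji (S_over_D Sv)).
Qed.

Section Gluing.
Context {Y : D -> topologicalType}.

Let slice_pt (i : D) u (Su : S (u, set_val i)) : [set u | S (u, set_val i)] :=
  exist _ u (mem_set Su).

Let index (v : S) : D :=
  exist _ (set_val v).2 (mem_set (S_over_D (set_valP v))).

Let indexP (v : S) : S ((set_val v).1, set_val (index v)).
Proof. by rewrite /= -surjective_pairing; exact: set_valP. Qed.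

Definition slices_to_sigT (f : forall i : D, [set u | S (u, set_val i)] -> Y i)
    (v : S) : {i : D & Y i} :=
  existT Y (index v) (f (index v) (slice_pt (indexP v))).

Definition sigT_to_slices (g : forall i : D, Y i -> [set u | S (u, set_val i)])
    (y : {i : D & Y i}) : S :=
  exist _ (set_val (g (projT1 y) (projT2 y)), set_val (projT1 y))
    (mem_set (set_valP (g (projT1 y) (projT2 y)))).

Let slices_to_sigTE f (i : D) (v : S) (Sv : S ((set_val v).1, set_val i)) :
  index v = i -> slices_to_sigT f v = existT Y i (f i (slice_pt Sv)).
Proof.
move=> vi; rewrite /slices_to_sigT; case: _ / vi in Sv *.
by congr existT; congr (f _ _); apply: val_inj.
Qed.

Lemma slices_to_sigTK f g : (forall i, cancel (f i) (g i)) ->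
  cancel (slices_to_sigT f) (sigT_to_slices g).
Proof.
by move=> fK v; apply: val_inj; rewrite /= fK; exact/esym/surjective_pairing.
Qed.

Lemma sigT_to_slicesK f g : (forall i, cancel (g i) (f i)) ->
  cancel (sigT_to_slices g) (slices_to_sigT f).
Proof.
move=> gK [i y].
rewrite (@slices_to_sigTE f i (sigT_to_slices g (existT _ i y))
  (set_valP (g i y))).
  by congr existT; rewrite -[RHS]gK; congr (f _ _); apply: val_inj.
exact: val_inj.
Qed.

Lemma slices_to_sigT_continuous f :
  (forall i, continuous (f i)) -> continuous (slices_to_sigT f).
Proof.
move=> contf v U fU; have [_ [[B oB <-] Bv BU]] := contf _ _ _ fU.
have near_v : \forall w \near set_val v,
    B w.1 /\ (D w.2 -> w.2 = (set_val v).2).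
  exists (B, [set i | D i -> i = (set_val v).2]); last by move=> [].
  by split; [exact: open_nbhs_nbhs|exact: D_discrete].
have {}near_v : \forall w \near v,
    B (set_val w).1 /\ (D (set_val w).2 -> (set_val w).2 = (set_val v).2).
  exact: initial_continuous near_v.
apply: filterS near_v => w [Bw /(_ (S_over_D (set_valP w))) wv].
have iw : index w = index v by exact: val_inj.
have Sw : S ((set_val w).1, set_val (index v)) by rewrite -iw; exact: indexP.
by rewrite /= (slices_to_sigTE _ Sw iw); exact: (BU (slice_pt Sw)).
Qed.

Lemma sigT_to_slices_continuous g :
  (forall i, continuous (g i)) -> continuous (sigT_to_slices g).
Proof.
move=> contg.
apply: (@sigT_continuous _ _ _
  (fun i y => sigT_to_slices g (existT Y i y))) => i.
apply: continuous_comp_initial => y; apply: cvg_pair; last exact: cvg_cst.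
apply: (@continuous_comp _ _ _ (g i) set_val); first exact: contg.
exact: initial_continuous.
Qed.

End Gluing.

Lemma homeomorphic_slices (Y : D -> topologicalType) :
  (forall i : D, homeomorphic [set u | S (u, set_val i)] (Y i)) ->
  homeomorphic S {i : D & Y i}.
Proof.
move=> homeoY; pose f i := projT1 (cid (homeoY i)).
pose g i := projT1 (cid (projT2 (cid (homeoY i)))).
have fgP i : [/\ cancel (f i) (g i), cancel (g i) (f i), continuous (f i) &
  continuous (g i)] := projT2 (cid (projT2 (cid (homeoY i)))).
exists (slices_to_sigT f), (sigT_to_slices g); split.
- by apply: slices_to_sigTK => i; case: (fgP i).
- by apply: sigT_to_slicesK => i; case: (fgP i).
- by apply: slices_to_sigT_continuous => i; case: (fgP i).
- by apply: sigT_to_slices_continuous => i; case: (fgP i).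
Qed.

End Slices.

(** * Euclidean vectors and spheres *)

Lemma continuous_sumr (R : realType) (T : topologicalType)
    (V : normedModType R) (I : finType) (f : I -> T -> V) :
  (forall i, continuous (f i)) -> continuous (fun x => \sum_i f i x).
Proof.
move=> contf; apply: (@continuous_big V I +%R 0 predT) => [|i _].
  exact: add_continuous.
exact: contf.
Qed.

Lemma mulmxr_continuous (R : realType) (d e : nat) (M : 'M[R]_(d, e)) :
  continuous (fun v : 'rV[R]_d => v *m M).
Proof.
rewrite (_ : mulmx^~ M = fun v : 'rV_d => \sum_i v 0 i *: row i M); last first.
  by apply/funext => v; exact: mulmx_sum_row.
apply: continuous_sumr => i v.
exact: cvgZ (@coord_continuous _ _ _ 0 i v) (cvg_cst _).
Qed.

Lemma closed_preimage1 (R : realType) (T : topologicalType)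
    (V : normedModType R) (f : T -> V) (a : V) :
  continuous f -> closed [set x | f x = a].
Proof.
move=> /continuous_closedP /(_ [set a]); apply.
by apply: accessible_closed_set1; exact/hausdorff_accessible/norm_hausdorff.
Qed.

Section DotProduct.
Context {R : realType} {d : nat}.
Implicit Types u v w : 'rV[R]_d.

Definition dotv u v : R := (u *m v^T) 0 0.

Lemma dotvE u v : dotv u v = \sum_i u 0 i * v 0 i.
Proof. by rewrite /dotv mxE; apply: eq_bigr => i _; rewrite mxE. Qed.

Lemma dotvC u v : dotv u v = dotv v u.
Proof. by rewrite !dotvE; apply: eq_bigr => i _; rewrite mulrC. Qed.

Lemma dotvDl u v w : dotv (u + v) w = dotv u w + dotv v w.
Proof. by rewrite /dotv mulmxDl mxE. Qed.

Lemma dotvDr u v w : dotv w (u + v) = dotv w u + dotv w v.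
Proof. by rewrite dotvC dotvDl !(dotvC w). Qed.

Lemma dotvZl a u v : dotv (a *: u) v = a * dotv u v.
Proof. by rewrite /dotv -scalemxAl mxE. Qed.

Lemma dotvZr a u v : dotv u (a *: v) = a * dotv u v.
Proof. by rewrite dotvC dotvZl dotvC. Qed.

Lemma dotvNl u v : dotv (- u) v = - dotv u v.
Proof. by rewrite -scaleN1r dotvZl mulN1r. Qed.

Lemma dotvBl u v w : dotv (u - v) w = dotv u w - dotv v w.
Proof. by rewrite dotvDl dotvNl. Qed.

Lemma dotv0r u : dotv u 0 = 0.
Proof. by rewrite -(scale0r 0) dotvZr mul0r. Qed.

Lemma dotv_delta u i : dotv u (delta_mx 0 i) = u 0 i.
Proof. by rewrite /dotv trmx_delta -colE mxE. Qed.

Lemma dotv_suml (I : finType) (P : pred I) (f : I -> 'rV[R]_d) v :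
  dotv (\sum_(i | P i) f i) v = \sum_(i | P i) dotv (f i) v.
Proof. by rewrite /dotv mulmx_suml summxE. Qed.

Lemma dotv_mulmx u v (M : 'M[R]_d) : dotv (u *m M) v = dotv u (v *m M^T).
Proof. by rewrite /dotv trmx_mul trmxK mulmxA. Qed.

Lemma dotv_skew (M : 'M[R]_d) u : M^T = - M -> dotv u (u *m M) = 0.
Proof.
move=> M_skew; have : dotv u (u *m M) = - dotv u (u *m M).
  by rewrite {1}dotvC dotv_mulmx M_skew mulmxN dotvC dotvNl dotvC.
by move/eqP; rewrite -subr_eq0 opprK -mulr2n mulrn_eq0 => /eqP.
Qed.

Lemma sqnormE u : sqnorm u = dotv u u.
Proof. by rewrite dotvE; apply: eq_bigr => i _; rewrite expr2. Qed.

Lemma sqnorm_ge0 u : 0 <= sqnorm u.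
Proof. by apply: sumr_ge0 => i _; exact: sqr_ge0. Qed.

Lemma sqnorm_eq0 u : (sqnorm u == 0) = (u == 0).
Proof.
rewrite /sqnorm psumr_eq0 => [|i _]; last exact: sqr_ge0.
apply/allP/eqP => [u0|-> i _]; last by rewrite mxE expr0n eqxx implybT.
apply/rowP => i; rewrite mxE; apply/eqP; rewrite -sqrf_eq0.
exact: u0 (mem_index_enum i).
Qed.

Lemma sqnorm0 : sqnorm (0 : 'rV[R]_d) = 0.
Proof. by apply/eqP; rewrite sqnorm_eq0. Qed.

Lemma sqnorm_gt0 u : (0 < sqnorm u) = (u != 0).
Proof. by rewrite lt_neqAle sqnorm_ge0 andbT eq_sym sqnorm_eq0. Qed.

Lemma sqnormZ a u : sqnorm (a *: u) = a ^+ 2 * sqnorm u.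
Proof. by rewrite !sqnormE dotvZl dotvZr mulrA expr2. Qed.

Lemma sqnormD u v : sqnorm (u + v) = sqnorm u + 2 * dotv u v + sqnorm v.
Proof. rewrite !sqnormE dotvDl !dotvDr (dotvC v u); ring. Qed.

Lemma sqnorm_continuous : continuous (@sqnorm R d).
Proof.
apply: continuous_sumr => i; under eq_fun do rewrite expr2.
have coord_cvg v := @coord_continuous _ _ _ 0 i v.
by move=> v; exact: cvgM (coord_cvg v) (coord_cvg v).
Qed.

End DotProduct.

Section Normalize.
Context {R : realType} {d : nat}.
Implicit Types v : 'rV[R]_d.

Definition normalize v : 'rV[R]_d := (Num.sqrt (sqnorm v))^-1 *: v.

Lemma sqnorm_normalize v : v != 0 -> sqnorm (normalize v) = 1.
Proof.
move=> v0; rewrite sqnormZ exprVn sqr_sqrtr ?sqnorm_ge0// mulVf//.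
by rewrite sqnorm_eq0.
Qed.

Lemma normalizeZ (a : R) v : 0 < a -> normalize (a *: v) = normalize v.
Proof.
move=> a0; rewrite /normalize sqnormZ sqrtrM ?sqr_ge0// sqrtr_sqr gtr0_norm//.
by rewrite invfM scalerA mulrAC mulVf ?mul1r// gt_eqF.
Qed.

Lemma normalize_unit v : sqnorm v = 1 -> normalize v = v.
Proof. by move=> v1; rewrite /normalize v1 sqrtr1 invr1 scale1r. Qed.

Lemma normalizeK v : Num.sqrt (sqnorm v) *: normalize v = v.
Proof.
have [->|v0] := eqVneq v 0; first by rewrite /normalize !scaler0.
by rewrite scalerA divff ?scale1r// sqrtr_eq0 -ltNge sqnorm_gt0.
Qed.

Lemma normalize_continuous v : v != 0 -> {for v, continuous normalize}.
Proof.
move=> v0.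
have sqrt_cvg : Num.sqrt (sqnorm w) @[w --> v] --> Num.sqrt (sqnorm v).
  apply: (@continuous_comp _ _ _ (@sqnorm R d) (@Num.sqrt R)).
    exact: sqnorm_continuous.
  exact: sqrt_continuous.
have sqrt_neq0 : Num.sqrt (sqnorm v) != 0.
  by rewrite sqrtr_eq0 -ltNge sqnorm_gt0.
exact: cvgZ (cvgV sqrt_neq0 sqrt_cvg) (@cvg_id _ (nbhs v)).
Qed.

End Normalize.

Section AffineSphere.
Context {R : realType} {d : nat} (Q : 'M[R]_d) (b : 'rV[R]_d) (r : R).

Definition affine_sphere : set 'rV[R]_d :=
  [set u | u - u *m Q = b /\ sqnorm (u *m Q) = r].

Lemma closed_affine_sphere : closed affine_sphere.
Proof.
apply: (@closedI _ [set u | u - u *m Q = b] [set u | sqnorm (u *m Q) = r]).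
  apply: closed_preimage1 => u.
  apply: (@continuousB _ _ _ id (mulmxr Q)); first exact: cvg_id.
  exact: mulmxr_continuous.
apply: closed_preimage1 => u.
apply: (@continuous_comp _ _ _ (mulmxr Q) (@sqnorm R d)).
  exact: mulmxr_continuous.
exact: sqnorm_continuous.
Qed.

Hypothesis Q_idem : Q *m Q = Q.

Lemma sqnorm_affine_sphere u :
  Q^T = Q -> affine_sphere u -> sqnorm u = sqnorm b + r.
Proof.
move=> Q_sym [ub uQr]; rewrite -{1}(subrK (u *m Q) u) ub sqnormD uQr.
by rewrite -{2}ub dotvC dotv_mulmx Q_sym mulmxBl -mulmxA Q_idem subrr dotv0r
  mulr0 addr0.
Qed.

Hypothesis bQ : b *m Q = 0.
Hypothesis r_gt0 : 0 < r.

Let T := row_base Q.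

Let TQ : T *m Q = T.
Proof.
have /submxP[X ->] : (T <= Q)%MS by rewrite eq_row_base.
by rewrite -mulmxA Q_idem.
Qed.

Let TK (v : 'rV[R]_(\rank Q)) : v *m T *m pinvmx T = v.
Proof. by apply: mulmxKp; exact: row_base_free. Qed.

Let QT (u : 'rV[R]_d) : u *m Q *m pinvmx T *m T = u *m Q.
Proof. by apply: mulmxKpV; rewrite eq_row_base submxMl. Qed.

Let to_sphere (u : 'rV[R]_d) : 'rV[R]_(\rank Q) :=
  normalize (u *m Q *m pinvmx T).

Let of_sphere (v : 'rV[R]_(\rank Q)) : 'rV[R]_d :=
  b + Num.sqrt r *: normalize (v *m T).

Let coords_neq0 u : affine_sphere u -> u *m Q *m pinvmx T != 0.
Proof.
move=> [_ uQr]; have : u *m Q != 0 by rewrite -sqnorm_gt0 uQr.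
by apply: contraNneq => uQ0; rewrite -QT uQ0 mul0mx.
Qed.

Let mulT_neq0 (v : 'rV[R]_(\rank Q)) : sqnorm v = 1 -> v *m T != 0.
Proof.
move=> v1; have : v != 0 by rewrite -sqnorm_gt0 v1.
by apply: contraNneq => vT; rewrite -(TK v) vT mul0mx.
Qed.

Let of_sphereQ v : of_sphere v *m Q = Num.sqrt r *: normalize (v *m T).
Proof.
by rewrite mulmxDl bQ add0r /normalize -!scalemxAl -mulmxA TQ.
Qed.

Let to_sphereK : {in affine_sphere, cancel to_sphere of_sphere}.
Proof.
move=> u; rewrite inE => Su; have [ub uQr] := Su.
rewrite /of_sphere /to_sphere {2}/normalize -scalemxAl QT normalizeZ.
  by rewrite -uQr normalizeK -ub subrK.
by rewrite invr_gt0 sqrtr_gt0 sqnorm_gt0 coords_neq0.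
Qed.

Let of_sphereK : {in unit_sphere R (\rank Q), cancel of_sphere to_sphere}.
Proof.
move=> v; rewrite inE => v1; rewrite /to_sphere of_sphereQ {2}/normalize.
rewrite -!scalemxAl TK !normalizeZ ?sqrtr_gt0 ?normalize_unit//.
by rewrite invr_gt0 sqrtr_gt0 sqnorm_gt0 mulT_neq0.
Qed.

Lemma homeomorphic_affine_sphere :
  homeomorphic affine_sphere (unit_sphere R (\rank Q)).
Proof.
apply: (homeomorphic_sets _ _ to_sphereK of_sphereK).
- by move=> u Su; apply: sqnorm_normalize; exact: coords_neq0.
- move=> v v1; split; rewrite of_sphereQ; first by rewrite addrK.
  rewrite sqnormZ sqr_sqrtr ?ltW// sqnorm_normalize ?mulr1//.
  exact: mulT_neq0.
- move=> u; rewrite inE => Su.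
  have -> : to_sphere = fun w => normalize (w *m (Q *m pinvmx T)).
    by apply/funext => w; rewrite mulmxA.
  apply: (@continuous_comp _ _ _ (mulmxr (Q *m pinvmx T)) (@normalize R _)).
    exact: mulmxr_continuous.
  by apply: normalize_continuous; rewrite /= mulmxA coords_neq0.
- move=> v; rewrite inE => v1.
  have mulT_cvg : normalize (w *m T) @[w --> v] --> normalize (v *m T).
    apply: (@continuous_comp _ _ _ (mulmxr T) (@normalize R _)).
      exact: mulmxr_continuous.
    by apply: normalize_continuous; exact: mulT_neq0.
  exact: cvgD (cvg_cst _) (cvgZ (cvg_cst _) mulT_cvg).
Qed.

End AffineSphere.

(** * Spectral calculus of a skew-symmetric matrix *)

Lemma mxminpoly_map_symmetric (R : rcfType) d (S : 'M[R]_d.+1) :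
  S^T = S -> exists rs : seq R,
    mxminpoly (map_mx (real_complex R) S) =
    \prod_(r <- undup rs) ('X - (real_complex R r)%:P).
Proof.
move=> S_sym; set SC := map_mx _ S.
have SC_herm : SC \is hermsymmx.
  apply: realsym_hermsym.
    by apply/is_hermitianmxP; rewrite scale1r map_mx_id// map_trmx S_sym.
  by apply/mxOverP => i j; rewrite mxE; apply/complex_realP; exists (S i j).
have /mxOverP diag_real := hermitian_spectral_diag_real SC_herm.
have /hermitian_normalmx/orthomx_spectralP := SC_herm.
set P := spectralmx SC; set D := spectral_diag SC => SC_diag.
exists [seq complex.Re (D 0 i) | i <- enum 'I_d.+1].
have DE : [seq D 0 i | i <- enum 'I_d.+1] =
    map (real_complex R) [seq complex.Re (D 0 i) | i <- enum 'I_d.+1].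
  rewrite -[RHS]map_comp; apply: eq_map => i /=.
  by apply/esym/RRe_real; exact: diag_real.
have P_unit : invmx P \in unitmx by rewrite unitmx_inv spectral_unit.
rewrite SC_diag -[X in _ *m X]invmxK -conjumx// mxminpoly_uconj//.
rewrite mxminpoly_diag DE undup_map_inj ?big_map//; exact: complexI.
Qed.

Lemma symmetric_diagonalizable (R : rcfType) d (S : 'M[R]_d) :
  S^T = S -> diagonalizable S.
Proof.
case: d S => [S _|d S S_sym].
  by rewrite (flatmx0 S); exact: diagonalizable0.
have [rs] := mxminpoly_map_symmetric S_sym; rewrite mxminpoly_map => minS.
apply/diagonalizableP; exists (undup rs); first exact: undup_uniq.
suff -> : mxminpoly S = \prod_(r <- undup rs) ('X - r%:P) by [].
apply: (@map_poly_inj _ _ (real_complex R)); rewrite minS rmorph_prod.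
by apply: eq_bigr => r _; rewrite rmorphB /= map_polyX map_polyC.
Qed.

Lemma capmx_kermx_tr (R : realType) p d (V : 'M[R]_(p, d)) :
  (V :&: kermx V^T)%MS = 0.
Proof.
apply/eqP/rowV0P => v; rewrite sub_capmx => /andP[/submxP[y vE] /sub_kermxP v0].
apply/eqP; rewrite -sqnorm_eq0 sqnormE /dotv {2}vE trmx_mul mulmxA v0.
by rewrite mul0mx mxE.
Qed.

Lemma gram_eigenvalue_ge0 (R : realType) d (A : 'M[R]_d) (a : R) :
  eigenvalue (A^T *m A) a -> 0 <= a.
Proof.
move=> /eigenvalueP[v vA v0]; rewrite -(pmulr_lge0 _ (_ : 0 < sqnorm v)).
  by rewrite sqnormE -dotvZl -vA mulmxA dotv_mulmx -sqnormE sqnorm_ge0.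
by rewrite sqnorm_gt0.
Qed.

(* Locked: proj_mx is itself a product of matrices, which rewriting with
   mulmxA would otherwise unfold. *)
HB.lock Definition spec_proj (R : realType) (d k : nat) (A : 'M[R]_d)
    (alpha : 'I_k -> R) (j : 'I_k) : 'M[R]_d :=
  proj_mx (invariant_space A (alpha j)) (kermx (invariant_space A (alpha j))^T).

Section SkewSpectral.
Context {R : realType} {d : nat} (A : 'M[R]_d).
Context {k : nat} (alpha : 'I_k -> R) (m : 'I_k -> nat).
Hypothesis A_skew : A^T = - A.
Hypothesis Halpha : distinct_singular_values A alpha m.

Let E j := invariant_space A (alpha j).
Let S := A^T *m A.

Local Notation P := (spec_proj A alpha).

Let S_sym : S^T = S. Proof. by rewrite /S trmx_mul trmxK. Qed.

Let SE : S = - (A *m A). Proof. by rewrite /S A_skew mulNmx. Qed.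

Let sqr_alpha_inj : injective (fun j => alpha j ^+ 2).
Proof.
have lt_alpha := dsv_increasing Halpha; move=> i j /= /eqP.
rewrite eqrXn2 ?ltW ?(dsv_pos Halpha)// => /eqP ij; apply: val_inj.
by case: (ltngtP (val i) (val j)) => // /lt_alpha; rewrite ij ltxx.
Qed.

Let eigenP j p (M : 'M[R]_(p, d)) :
  reflect (M *m S = alpha j ^+ 2 *: M) (M <= E j)%MS.
Proof. exact: eigenspaceP. Qed.

Let orth_eigen i j p q (M : 'M[R]_(p, d)) (M' : 'M[R]_(q, d)) : i != j ->
  (M <= E i)%MS -> (M' <= E j)%MS -> M *m M'^T = 0.
Proof.
move=> ij /eigenP ME /eigenP M'E.
have : alpha i ^+ 2 *: (M *m M'^T) = alpha j ^+ 2 *: (M *m M'^T).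
  by rewrite scalemxAl -ME -mulmxA -{1}S_sym -trmx_mul M'E linearZ -scalemxAr.
move/eqP; rewrite -subr_eq0 -scalerBl scaler_eq0 => /orP[|/eqP//].
by rewrite subr_eq0 => /eqP /sqr_alpha_inj /eqP; rewrite (negPf ij).
Qed.

Let proj_id j p (M : 'M[R]_(p, d)) : (M <= E j)%MS -> M *m P j = M.
Proof. by move=> ME; rewrite spec_proj.unlock proj_mx_id ?capmx_kermx_tr. Qed.

Let proj_other i j p (M : 'M[R]_(p, d)) :
  i != j -> (M <= E i)%MS -> M *m P j = 0.
Proof.
move=> ij ME; rewrite spec_proj.unlock proj_mx_0 ?capmx_kermx_tr//.
by apply/sub_kermxP; exact: orth_eigen ij ME (submx_refl _).
Qed.

Let proj_sub j : (P j <= E j)%MS.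
Proof. by rewrite -[P j]mul1mx spec_proj.unlock proj_mx_sub. Qed.

Let eigenspace_sub_sum (a : R) : (eigenspace S a <= \sum_j E j)%MS.
Proof.
have [->|Sa] := eqVneq (eigenspace S a) 0; first exact: sub0mx.
have a0 : 0 <= a by exact: gram_eigenvalue_ge0 Sa.
have [j ja] : exists j, alpha j = Num.sqrt a.
  apply/(dsv_values Halpha); split; first exact: sqrtr_ge0.
  by rewrite sqr_sqrtr.
apply: (sumsmx_sup j) => //.
by rewrite /E /invariant_space ja sqr_sqrtr.
Qed.

Let sum_eigen p (M : 'M[R]_(p, d)) : (M <= \sum_j E j)%MS.
Proof.
apply: submx_trans (submx1 M) _.
have /diagonalizablePeigen[rs _ <-] := symmetric_diagonalizable S_sym.
apply: (@big_ind _ (fun U : 'M[R]_d => (U <= \sum_j E j)%MS))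
  => [|U V UE VE|r _].
- exact: sub0mx.
- by rewrite addsmx_sub UE.
- exact: eigenspace_sub_sum.
Qed.

Lemma sum_spec_proj : \sum_j P j = 1%:M.
Proof.
rewrite -[LHS]mul1mx mulmx_sumr.
have /sub_sumsmxP[u uE] := sum_eigen 1%:M.
rewrite [RHS]uE; apply: eq_bigr => j _.
rewrite uE mulmx_suml (bigD1 j)//= proj_id ?submxMl// big1 ?addr0// => i ij.
by rewrite (proj_other ij)// submxMl.
Qed.

Lemma spec_projM j : P j *m P j = P j.
Proof. exact: proj_id. Qed.

Lemma spec_proj_orth i j : i != j -> P i *m P j = 0.
Proof. by move=> ij; exact: proj_other ij (proj_sub i). Qed.

Lemma spec_proj_comm j : A *m P j = P j *m A.
Proof.
have E_stable i : (P i *m A <= E i)%MS.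
  have AS : A *m S = S *m A by rewrite SE mulmxN mulNmx mulmxA.
  have /eigenP PE := proj_sub i; apply/eigenP.
  by rewrite -mulmxA AS mulmxA PE -scalemxAl.
rewrite -{1}(mul1mx A) -sum_spec_proj !mulmx_suml (bigD1 j)//= big1.
  by rewrite addr0 proj_id.
by move=> i ij; rewrite (proj_other ij).
Qed.

Lemma spec_proj_sqr j : P j *m A *m A = - (alpha j ^+ 2) *: P j.
Proof.
have /eigenP := proj_sub j.
by rewrite SE mulmxN mulmxA scaleNr => <-; rewrite opprK.
Qed.

Lemma spec_proj_tr j : (P j)^T = P j.
Proof.
have PPT i l : i != l -> P i *m (P l)^T = 0.
  by move=> il; exact: orth_eigen il (proj_sub i) (proj_sub l).
have PT : (P j)^T = P j *m (P j)^T.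
  rewrite -[LHS]mul1mx -sum_spec_proj mulmx_suml (bigD1 j)//= big1 ?addr0//.
  by move=> i ij; exact: PPT.
by rewrite PT; have := congr1 trmx PT; rewrite trmx_mul !trmxK.
Qed.

Lemma rank_sum_spec_proj (Q : pred 'I_k) :
  \rank (\sum_(j | Q j) P j)%R = (\sum_(j | Q j) m j).*2.
Proof.
have -> : \rank (\sum_(j | Q j) P j)%R = \rank (\sum_(j | Q j) E j)%MS.
  apply/eqP; rewrite eqn_leq; apply/andP; split; apply: mxrankS.
    by apply: summx_sub => j Qj; apply: (sumsmx_sup j).
  apply/sumsmx_subP => j Qj.
  have -> : E j = E j *m \sum_(j | Q j) P j.
    rewrite mulmx_sumr (bigD1 j)//= proj_id// big1 ?addr0// => i /andP[_ ij].
    by apply: (@proj_other j); rewrite // eq_sym.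
  exact: submxMl.
have inj : {in Q &, injective (fun j => alpha j ^+ 2)}.
  by move=> i j _ _; exact: sqr_alpha_inj.
have /mxdirectP /= -> := mxdirect_sum_eigenspace S inj.
rewrite -muln2 big_distrl /=; apply: eq_bigr => j _.
by rewrite muln2 -(dsv_mult Halpha).
Qed.

Implicit Types (u v : 'rV[R]_d) (c s r theta : 'I_k -> R).

(* A / alpha_j is a complex structure on the range of P_j, so this is the
   matrix acting there as the multiplication by c_j + i s_j. *)
Definition spec_mx c s : 'M[R]_d :=
  \sum_j (c j *: P j + (s j / alpha j) *: (P j *m A)).

Definition spec_polar r theta : 'M[R]_d :=
  spec_mx (fun j => r j * cos (theta j)) (fun j => r j * sin (theta j)).

Let alpha_neq0 j : alpha j != 0.
Proof. by rewrite gt_eqF// (dsv_pos Halpha). Qed.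

Let projPA i j : P i *m A *m P j = P i *m P j *m A.
Proof. by rewrite -mulmxA spec_proj_comm mulmxA. Qed.

Lemma eq_spec_mx c s c' s' : c =1 c' -> s =1 s' -> spec_mx c s = spec_mx c' s'.
Proof. by move=> cc ss; apply: eq_bigr => j _; rewrite cc ss. Qed.

Lemma spec_mxZ a c s :
  a *: spec_mx c s = spec_mx (fun j => a * c j) (fun j => a * s j).
Proof.
rewrite scaler_sumr; apply: eq_bigr => j _.
by rewrite scalerDr !scalerA mulrA.
Qed.

Lemma spec_mxB c s c' s' : spec_mx c s - spec_mx c' s' =
  spec_mx (fun j => c j - c' j) (fun j => s j - s' j).
Proof.
rewrite -sumrB; apply: eq_bigr => j _.
by rewrite mulrBl !scalerBl opprD addrACA.
Qed.

Lemma mul_sum_spec_proj (Q : pred 'I_k) i :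
  (\sum_(j | Q j) P j) *m P i = if Q i then P i else 0.
Proof.
rewrite mulmx_suml; case: ifPn => Qi.
  rewrite (bigD1 i)//= spec_projM big1 ?addr0// => j /andP[_].
  exact: spec_proj_orth.
rewrite big1// => j Qj; apply: spec_proj_orth.
by apply: contraNneq Qi => <-.
Qed.

Lemma sum_spec_projM (Q : pred 'I_k) :
  (\sum_(j | Q j) P j) *m (\sum_(j | Q j) P j) = \sum_(j | Q j) P j.
Proof.
by rewrite mulmx_sumr; apply: eq_bigr => i Qi; rewrite mul_sum_spec_proj Qi.
Qed.

Lemma sum_spec_proj_tr (Q : pred 'I_k) :
  (\sum_(j | Q j) P j)^T = \sum_(j | Q j) P j.
Proof. by rewrite raddf_sum; apply: eq_bigr => j _; exact: spec_proj_tr. Qed.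

Lemma sum_spec_proj_spec_mx (Q : pred 'I_k) :
  \sum_(j | Q j) P j = spec_mx (fun j => (Q j)%:R) (fun=> 0).
Proof.
rewrite big_mkcond; apply: eq_bigr => j _.
by rewrite mul0r scale0r addr0; case: (Q j); rewrite ?scale1r ?scale0r.
Qed.

Lemma spec_mx1 : spec_mx (fun=> 1) (fun=> 0) = 1%:M.
Proof. by rewrite -sum_spec_proj sum_spec_proj_spec_mx. Qed.

Lemma spec_mx_alpha : spec_mx (fun=> 0) alpha = A.
Proof.
rewrite -[RHS]mul1mx -sum_spec_proj mulmx_suml.
by apply: eq_bigr => j _; rewrite divff// scale0r add0r scale1r.
Qed.

Lemma mul_spec_proj_mx c s j :
  P j *m spec_mx c s = c j *: P j + (s j / alpha j) *: (P j *m A).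
Proof.
rewrite /spec_mx mulmx_sumr (bigD1 j)//= big1 ?addr0 => [|i ij].
  by rewrite mulmxDr -!scalemxAr mulmxA spec_projM.
rewrite mulmxDr -!scalemxAr mulmxA spec_proj_orth 1?eq_sym//.
by rewrite mul0mx !scaler0 addr0.
Qed.

Lemma spec_mx_comm c s j : spec_mx c s *m P j = P j *m spec_mx c s.
Proof.
rewrite /spec_mx mulmx_suml mulmx_sumr; apply: eq_bigr => i _.
rewrite mulmxDl mulmxDr -!scalemxAl -!scalemxAr projPA mulmxA.
have [->//|ij] := eqVneq i j.
have ji : j != i by rewrite eq_sym.
by rewrite (spec_proj_orth ij) (spec_proj_orth ji).
Qed.

Lemma spec_mxM c s c' s' : spec_mx c s *m spec_mx c' s' =
  spec_mx (fun j => c j * c' j - s j * s' j) (fun j => c j * s' j + s j * c' j).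
Proof.
rewrite {1}/spec_mx mulmx_suml; apply: eq_bigr => j _.
rewrite mulmxDl -!scalemxAl -spec_proj_comm -mulmxA mul_spec_proj_mx.
rewrite mulmxDr -!scalemxAr !mulmxA spec_proj_comm spec_proj_sqr.
rewrite !scalerDr !scalerA [X in _ + X = _]addrC addrACA -!scalerDl.
by congr (_ *: _ + _ *: _); field; rewrite alpha_neq0.
Qed.

Lemma spec_mx_tr c s : (spec_mx c s)^T = spec_mx c (fun j => - s j).
Proof.
rewrite raddf_sum; apply: eq_bigr => j _ /=.
rewrite linearD !linearZ /= trmx_mul A_skew spec_proj_tr.
by rewrite mulNmx spec_proj_comm scalerN mulNr scaleNr.
Qed.

Lemma spec_mx_mulA c s : spec_mx c s *m A =
  spec_mx (fun j => - (s j * alpha j)) (fun j => c j * alpha j).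
Proof.
rewrite -[X in _ *m X]spec_mx_alpha spec_mxM; apply: eq_spec_mx => j; ring.
Qed.

Lemma mul_spec_polar r theta r' theta' :
  spec_polar r theta *m spec_polar r' theta' =
  spec_polar (fun j => r j * r' j) (fun j => theta j + theta' j).
Proof.
rewrite /spec_polar spec_mxM; apply: eq_spec_mx => j; rewrite ?cosD ?sinD; ring.
Qed.

Lemma mul_spec_polar_inv (Q : pred 'I_k) r theta r' theta' :
  (forall j, r j * r' j = (~~ Q j)%:R) -> (forall j, theta j + theta' j = 0) ->
  spec_polar r theta *m spec_polar r' theta' = 1%:M - \sum_(j | Q j) P j.
Proof.
move=> r_inv theta_opp.
rewrite mul_spec_polar -spec_mx1 sum_spec_proj_spec_mx spec_mxB.
apply: eq_spec_mx => j; rewrite r_inv theta_opp ?cos0 ?sin0 ?mulr0 ?subrr//.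
by rewrite mulr1; case: (Q j); rewrite ?subrr ?subr0.
Qed.

Lemma spec_polar_mul_sum (Q : pred 'I_k) r theta : (forall j, Q j -> r j = 0) ->
  spec_polar r theta *m \sum_(j | Q j) P j = 0.
Proof.
move=> r0; rewrite mulmx_sumr big1// => j Qj.
by rewrite spec_mx_comm mul_spec_proj_mx r0// !mul0r !scale0r addr0.
Qed.

Lemma sum_mul_spec_polar (Q : pred 'I_k) r theta : (forall j, Q j -> r j = 0) ->
  (\sum_(j | Q j) P j) *m spec_polar r theta = 0.
Proof.
move=> r0; rewrite mulmx_suml big1// => j Qj.
by rewrite mul_spec_proj_mx r0// !mul0r !scale0r addr0.
Qed.

Lemma spec_ext u v : (forall j, u *m P j = v *m P j) -> u = v.
Proof.
move=> uv; rewrite -(mulmx1 u) -(mulmx1 v) -sum_spec_proj !mulmx_sumr.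
by apply: eq_bigr => j _.
Qed.

Lemma dotv_spec u v : dotv u v = \sum_j dotv (u *m P j) (v *m P j).
Proof.
rewrite -{1}(mulmx1 u) -sum_spec_proj mulmx_sumr dotv_suml.
apply: eq_bigr => j _.
by rewrite -{1}spec_projM mulmxA dotv_mulmx spec_proj_tr.
Qed.

Lemma sqnorm_spec u : sqnorm u = \sum_j sqnorm (u *m P j).
Proof. by rewrite sqnormE dotv_spec; under eq_bigr do rewrite -sqnormE. Qed.

Lemma sqnorm_mul_sum_spec_proj (Q : pred 'I_k) u :
  sqnorm (u *m \sum_(j | Q j) P j) = \sum_(j | Q j) sqnorm (u *m P j).
Proof.
rewrite sqnorm_spec [RHS]big_mkcond; apply: eq_bigr => j _.
rewrite -mulmxA mul_sum_spec_proj; case: ifP => // _.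
by rewrite mulmx0 sqnorm0.
Qed.

Lemma dotv_mul_spec_mx c s u :
  dotv u (u *m spec_mx c s) = \sum_j c j * sqnorm (u *m P j).
Proof.
rewrite dotv_spec; apply: eq_bigr => j _.
rewrite -mulmxA spec_mx_comm mul_spec_proj_mx mulmxDr -!scalemxAr mulmxA.
by rewrite dotvDr !dotvZr dotv_skew// mulr0 addr0 sqnormE.
Qed.

Lemma sqnorm_mul_spec_mx c s u : sqnorm (u *m spec_mx c s) =
  \sum_j (c j ^+ 2 + s j ^+ 2) * sqnorm (u *m P j).
Proof.
rewrite sqnormE dotv_mulmx -mulmxA spec_mx_tr spec_mxM dotv_mul_spec_mx.
by apply: eq_bigr => j _; congr (_ * _); ring.
Qed.

Lemma sqnorm_mul_spec_polar_proj r theta u j :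
  sqnorm (u *m spec_polar r theta *m P j) = r j ^+ 2 * sqnorm (u *m P j).
Proof.
rewrite -mulmxA spec_mx_comm mulmxA sqnorm_mul_spec_mx (bigD1 j)//=.
rewrite -mulmxA spec_projM big1 ?addr0 => [|i ij].
  by rewrite !exprMn -mulrDr cos2Dsin2 mulr1.
by rewrite -mulmxA spec_proj_orth 1?eq_sym// mulmx0 sqnorm0 mulr0.
Qed.

End SkewSpectral.

(** * Derivatives *)

Lemma is_deriveP (R : numFieldType) (U V : normedModType R) (f : U -> V)
    (x v : U) (df : V) :
  h^-1 *: (f (h *: v + x) - f x) @[h --> 0^'] --> df <-> is_derive x v f df.
Proof.
split=> [f_cvg|[f_cvg <-]]; last exact: f_cvg.
apply: DeriveDef; first by apply/cvg_ex; exists df.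
exact/cvg_lim.
Qed.

Section Derivatives.
Context {R : numFieldType} {U V W : normedModType R}.
Implicit Types x v : U.

Lemma is_derive_linear (phi : V -> W) (f : U -> V) x v (df : V) :
  linear phi -> continuous phi ->
  is_derive x v f df -> is_derive x v (fun y => phi (f y)) (phi df).
Proof.
move=> phi_lin phi_cont /is_deriveP f_cvg; apply/is_deriveP.
pose Phi : {linear V -> W} :=
  HB.pack phi (GRing.isLinear.Build _ _ _ _ _ phi_lin).
have phiZB a y z : phi (a *: (y - z)) = a *: (phi y - phi z).
  by rewrite -[phi _]/(Phi _) linearZ_LR linearB.
rewrite (_ : (fun h => _) =
    phi \o (fun h => h^-1 *: (f (h *: v + x) - f x))); last first.
  by apply/funext => h /=; rewrite phiZB.
exact: (cvg_comp _ _ f_cvg (phi_cont df)).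
Qed.

Lemma is_derive_pair (f : U -> V) (g : U -> W) x v (df : V) (dg : W) :
  is_derive x v f df -> is_derive x v g dg ->
  is_derive x v (fun y => (f y, g y)) (df, dg).
Proof.
move=> /is_deriveP f_cvg /is_deriveP g_cvg; apply/is_deriveP.
exact: cvg_pair f_cvg g_cvg.
Qed.

End Derivatives.

Section DerivativesInComponents.
Context {R : numFieldType} {U V W : normedModType R}.
Implicit Types x v : U.

Lemma is_derive_fst (f : U -> V * W) x v (df : V * W) :
  is_derive x v f df -> is_derive x v (fun y => (f y).1) df.1.
Proof. by apply: (is_derive_linear (phi := fst)) => // z; exact: cvg_fst. Qed.

Lemma is_derive_snd (f : U -> V * W) x v (df : V * W) :
  is_derive x v f df -> is_derive x v (fun y => (f y).2) df.2.
Proof. by apply: (is_derive_linear (phi := snd)) => // z; exact: cvg_snd. Qed.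

Lemma is_derive_scalel (f : U -> R) x v (df : R) (w : V) :
  is_derive x v f df -> is_derive x v (fun y => f y *: w) (df *: w).
Proof.
apply: (is_derive_linear (phi := fun a : R => a *: w)).
  by move=> a b c; rewrite scalerDl scalerA.
exact: scalel_continuous.
Qed.

Lemma is_derive_sumr n (f : 'I_n -> U -> V) x v (df : 'I_n -> V) :
  (forall i, is_derive x v (f i) (df i)) ->
  is_derive x v (fun y => \sum_i f i y) (\sum_i df i).
Proof.
move=> /is_derive_sum; rewrite (_ : \sum_i f i = fun y => \sum_i f i y)//.
by apply/funext => y; rewrite fct_sumE.
Qed.

End DerivativesInComponents.

Section DerivativesOfVectors.
Context {R : realType} {d : nat}.
Implicit Types (f g : R -> 'rV[R]_d) (t : R) (df dg : 'rV[R]_d).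

Lemma is_derive_coord f t df i :
  is_derive t 1 f df -> is_derive t 1 (fun s => f s 0 i) (df 0 i).
Proof.
apply: (is_derive_linear (phi := fun v : 'rV_d => v 0 i)).
  by move=> a u v; rewrite !mxE.
exact: coord_continuous.
Qed.

Lemma is_derive_mulmx e (M : 'M[R]_(d, e)) f t df :
  is_derive t 1 f df -> is_derive t 1 (fun s => f s *m M) (df *m M).
Proof.
apply: (is_derive_linear (phi := mulmxr M)); last exact: mulmxr_continuous.
by move=> a u v /=; rewrite mulmxDl scalemxAl.
Qed.

Lemma is_derive_dotv f g t df dg :
  is_derive t 1 f df -> is_derive t 1 g dg ->
  is_derive t 1 (fun s => dotv (f s) (g s)) (dotv df (g t) + dotv (f t) dg).
Proof.
move=> f_der g_der; under eq_fun do rewrite dotvE.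
have -> : dotv df (g t) + dotv (f t) dg =
    \sum_i (df 0 i * g t 0 i + f t 0 i * dg 0 i).
  by rewrite !dotvE -big_split.
apply: is_derive_sumr => i.
have fi := is_derive_coord i f_der; have gi := is_derive_coord i g_der.
by apply: is_derive_eq; rewrite addrC /GRing.scale/= (mulrC (g t 0 i)).
Qed.

End DerivativesOfVectors.

Section MeanValueTheorem.
Context {R : realType}.

Lemma eq_is_derive (f g df : R -> R) :
  (forall t : R, is_derive t 1 f (df t)) ->
  (forall t : R, is_derive t 1 g (df t)) -> f 0 = g 0 -> f =1 g.
Proof.
move=> f_der g_der fg0 t; apply/eqP; rewrite -subr_eq0; apply/eqP.
have fg_der (s : R) : is_derive s 1 (fun s => f s - g s) 0.
  by rewrite -(subrr (df s)); exact: is_deriveB.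
by rewrite (is_derive_0_is_cst t 0 fg_der) fg0 subrr.
Qed.

Lemma eq_is_derive_rV d (f g df : R -> 'rV[R]_d) :
  (forall t : R, is_derive t 1 f (df t)) ->
  (forall t : R, is_derive t 1 g (df t)) -> f 0 = g 0 -> f =1 g.
Proof.
move=> f_der g_der fg0 t; apply/rowP => i.
apply: (@eq_is_derive (fun s => f s 0 i) (fun s => g s 0 i)
  (fun s => df s 0 i)) => [s|s|]; last by rewrite fg0.
  exact: is_derive_coord.
exact: is_derive_coord.
Qed.

Lemma skew_flow_sqnorm d (A : 'M[R]_d) (h : R -> 'rV[R]_d) (l t : R) :
  A^T = - A -> (forall s : R, is_derive s 1 h (l *: (h s *m A))) ->
  sqnorm (h t) = sqnorm (h 0).
Proof.
move=> A_skew h_der; rewrite !sqnormE.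
apply: (is_derive_0_is_cst (f := fun s => dotv (h s) (h s))) => s.
apply: is_derive_eq (is_derive_dotv (h_der s) (h_der s)) _.
by rewrite dotvZl dotvZr dotvC dotv_skew// mulr0 addr0.
Qed.

Lemma MVT_is_derive (f f' : R -> R) (a b : R) : a < b ->
  (forall x, a <= x <= b -> is_derive x 1 f (f' x)) ->
  exists2 c, a < c < b & f b - f a = f' c * (b - a).
Proof.
move=> ab f_der; have [||c] := @MVT R f f' a b ab; last first.
- by rewrite in_itv /=; exists c.
- apply: derivable_within_continuous => x; rewrite in_itv /= => /f_der.
  by move=> ?; exact: ex_derive.
- by move=> x; rewrite in_itv /= => /andP[ax xb]; apply: f_der; rewrite !ltW.
Qed.

Lemma ltr_is_derive (f f' h h' : R -> R) (b : R) : f 0 = h 0 ->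
  (forall x : R, is_derive x 1 f (f' x)) ->
  (forall x : R, is_derive x 1 h (h' x)) ->
  (forall x, 0 < x < b -> f' x < h' x) -> forall x, 0 < x <= b -> f x < h x.
Proof.
move=> fh0 f_der h_der lt_der x /andP[x0 xb].
have [c /andP[c0 cx]] := @MVT_is_derive (fun y => h y - f y)
  (fun y => h' y - f' y) 0 x x0 (fun y _ => is_deriveB (h_der y) (f_der y)).
rewrite fh0 subrr !subr0 => hfE; rewrite -subr_gt0 hfE.
by rewrite mulr_gt0// subr_gt0 lt_der// c0 (lt_le_trans cx).
Qed.

Lemma convex_no_three_equal_values (f f1 f2 : R -> R) (a b c : R) :
  a < b -> b < c ->
  (forall x, a <= x <= c -> is_derive x 1 f (f1 x)) ->
  (forall x, a <= x <= c -> is_derive x 1 f1 (f2 x)) ->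
  (forall x, a <= x <= c -> 0 < f2 x) -> f a = f b -> f b = f c -> False.
Proof.
move=> ab bc f_der f1_der f2_gt0 fab fbc.
have rolle x y : a <= x -> x < y -> y <= c -> f x = f y ->
    exists2 t, x < t < y & f1 t = 0.
  move=> ax xy yc fxy; have [|t xty] := @MVT_is_derive f f1 x y xy.
    move=> s /andP[xs sy]; apply: f_der.
    by rewrite (le_trans ax xs) (le_trans sy yc).
  rewrite fxy subrr => /esym/eqP; rewrite mulf_eq0 subr_eq0 (gt_eqF xy) orbF.
  by move=> /eqP; exists t.
have [x /andP[ax xb] f1x] := rolle a b (lexx a) ab (ltW bc) fab.
have [y /andP[b_y yc] f1y] := rolle b c (ltW ab) bc (lexx c) fbc.
have xy : x < y := lt_trans xb b_y.
have in_ac s : x <= s <= y -> a <= s <= c.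
  by move=> /andP[xs sy]; rewrite (le_trans (ltW ax) xs) (le_trans sy (ltW yc)).
have [s /andP[xs sy]] :=
  @MVT_is_derive f1 f2 x y xy (fun s xsy => f1_der s (in_ac s xsy)).
rewrite f1x f1y subrr => /esym/eqP; rewrite gt_eqF// mulr_gt0 ?subr_gt0//.
by rewrite f2_gt0// in_ac// !ltW.
Qed.

End MeanValueTheorem.

Lemma is_derive_div (R : realType) (f h : R -> R) (x v df dh : R) :
  h x != 0 -> is_derive x v f df -> is_derive x v h dh ->
  is_derive x v (fun y => f y / h y) ((df * h x - f x * dh) / h x ^+ 2).
Proof.
move=> h0 f_der h_der; have hV_der := is_deriveV h0 h_der.
by apply: is_derive_eq; rewrite /GRing.scale /=; field.
Qed.

Section ExplicitDerivatives.
Context {R : realType}.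

Lemma derive_half_sqnorm (V : normedModType R) d (H : V -> R) (v w : V)
    (h e : 'rV[R]_d) :
  (forall a, H (a *: w + v) = 2^-1 * sqnorm (h + a *: e)) ->
  derive H v w = dotv h e.
Proof.
move=> HE; apply: derive_val; apply/is_deriveP.
pose phi (a : R) := 2^-1 * sqnorm h + a * dotv h e + a * a * (2^-1 * sqnorm e).
have phiE a : H (a *: w + v) = phi a.
  by rewrite HE sqnormD dotvZr sqnormZ /phi; field.
have growth_rateE : (fun a : R => a^-1 *: (H (a *: w + v) - H v)) =
    fun a : R => a^-1 *: (phi (a *: 1 + 0) - phi 0).
  by apply/funext => a; rewrite -!phiE scale0r add0r addr0 /GRing.scale/= mulr1.
rewrite growth_rateE; apply/is_deriveP.
by apply: is_derive_eq; rewrite /GRing.scale /=; ring.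
Qed.

Lemma is_derive_sin_mul (w t : R) :
  is_derive t 1 (fun s => sin (w * s)) (w * cos (w * t)).
Proof. by apply: is_derive_eq; rewrite /GRing.scale /= mulr1 mulrC. Qed.

Lemma is_derive_cos_mul (w t : R) :
  is_derive t 1 (fun s => cos (w * s)) (- (w * sin (w * t))).
Proof. by apply: is_derive_eq; rewrite /GRing.scale /= mulr1 mulrC mulrN. Qed.

Lemma is_derive_mul_spec_mx d (A : 'M[R]_d) k (alpha : 'I_k -> R)
    (c s : R -> 'I_k -> R) (dc ds : 'I_k -> R) (u : 'rV[R]_d) (t : R) :
  (forall j, is_derive t 1 (c^~ j) (dc j)) ->
  (forall j, is_derive t 1 (s^~ j) (ds j)) ->
  is_derive t 1 (fun r => u *m spec_mx A alpha (c r) (s r))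
    (u *m spec_mx A alpha dc ds).
Proof.
move=> c_der s_der.
pose P := spec_proj A alpha.
have spec_mxE x y : u *m spec_mx A alpha x y =
    \sum_j (x j *: (u *m P j) + (y j / alpha j) *: (u *m (P j *m A))).
  by rewrite mulmx_sumr; apply: eq_bigr => j _; rewrite mulmxDr -!scalemxAr.
under eq_fun do rewrite spec_mxE; rewrite spec_mxE; apply: is_derive_sumr => j.
have sj_der : is_derive t 1 (fun r => s r j / alpha j) (ds j / alpha j).
  rewrite mulrC; under eq_fun do rewrite mulrC.
  exact: is_deriveZ (s_der j).
exact: is_deriveD (is_derive_scalel _ (c_der j)) (is_derive_scalel _ sj_der).
Qed.

End ExplicitDerivatives.

(** * Contact Carnot groups in exponential coordinates *)

Section Bracket.
Context {R : realType} {n : nat} {G : contact_carnot R n}.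
Implicit Types u v w : G.

Lemma cc_br_is_bilinear :
  bilinear_for (GRing.Scale.Law.clone _ _ *:%R _)
    (GRing.Scale.Law.clone _ _ *:%R _) (@cc_br R n G).
Proof.
by split=> w a u v; [exact: cc_br_linearl|exact: cc_br_linearr].
Qed.

HB.instance Definition _ := bilinear_isBilinear.Build R G G G _ _
  (@cc_br R n G) cc_br_is_bilinear.

Lemma cc_br_antisym u v : cc_br u v = - cc_br v u.
Proof.
have := cc_br_alternating (u + v).
rewrite linearDl !linearDr /= !cc_br_alternating.
by rewrite addr0 add0r => /eqP; rewrite addr_eq0 => /eqP.
Qed.

Lemma cc_br_g2 u v : u \in cc_g1 G -> v \in cc_g1 G -> cc_br u v \in cc_g2 G.
Proof.
move=> u1 v1; rewrite (coord_vbasis u1) linear_sumlz.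
apply: memv_suml => i _; rewrite linearZl_LR; apply: memvZ.
rewrite (coord_vbasis v1) linear_sumr.
apply: memv_suml => j _; rewrite linearZr_LR; apply: memvZ.
rewrite -(cc_br11 G); apply/memv_span/allpairsP.
exists ((vbasis (cc_g1 G))`_i, (vbasis (cc_g1 G))`_j) => /=.
by split => //; apply: mem_nth; rewrite size_tuple.
Qed.

End Bracket.

Section CarnotCoordinates.
Context {R : realType} {n : nat} {G : contact_carnot R n}.
Variable F : adapted_frame G.
Implicit Types (p q w : coords R n) (s : coords R n * coords R n).

Let frame : (n.*2).+1.-tuple G := [tuple of frame0 F :: frame1 F].
Local Notation A := (bracket_mx F).

Let frame_free : free frame.
Proof.
have frame0_neq0 : frame0 F != 0.
  apply/eqP => f0; have := cc_dim2 G.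
  by rewrite -(frame0_gen F) f0 dim_vline eqxx.
have := frame1_basis F => /andP[/eqP span1 free1].
rewrite /= -cat1s cat_free free1 seq1_free frame0_neq0 /= span1.
rewrite span_seq1 frame0_gen.
by have /directv_addP := cc_direct G; rewrite capvC => /directv_addP.
Qed.

Let tnth_frame1 i : tnth (frame1 F) i = frame`_(lift ord0 i).
Proof. by rewrite (tnth_nth 0). Qed.

Let coord00 : coord frame ord0 (frame0 F) = 1.
Proof. by have := coord_free ord0 ord0 frame_free; rewrite eqxx. Qed.

Let coord0i i : coord frame ord0 (tnth (frame1 F) i) = 0.
Proof. by rewrite tnth_frame1 coord_free. Qed.

Let coordi0 i : coord frame (lift ord0 i) (frame0 F) = 0.
Proof. by have := coord_free ord0 (lift ord0 i) frame_free. Qed.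

Let coordij i j : coord frame (lift ord0 i) (tnth (frame1 F) j) = (j == i)%:R.
Proof. by rewrite tnth_frame1 coord_free// (inj_eq lift_inj). Qed.

Lemma bracket_mxE i j :
  cc_br (tnth (frame1 F) i) (tnth (frame1 F) j) = A i j *: frame0 F.
Proof.
have frame1_g1 l : tnth (frame1 F) l \in cc_g1 G.
  by apply: (basis_mem (frame1_basis F)); exact: mem_tnth.
have := cc_br_g2 (frame1_g1 i) (frame1_g1 j).
rewrite -(frame0_gen F) => /vlineP[c cE].
by rewrite mxE cE linearZ /= coord00 mulr1.
Qed.

Lemma bracket_mx_skew : A^T = - A.
Proof. by apply/matrixP => i j; rewrite !mxE cc_br_antisym linearN. Qed.

Lemma cc_br_exp_coords p q :
  cc_br (exp_coords F p) (exp_coords F q) = dotv (p.1 *m A) q.1 *: frame0 F.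
Proof.
have sum_g1 (u : 'rV[R]_(n.*2)) : \sum_i u 0 i *: tnth (frame1 F) i \in cc_g1 G.
  apply: memv_suml => i _; apply: memvZ.
  by apply: (basis_mem (frame1_basis F)); exact: mem_tnth.
have scale_g2 (a : R) : a *: frame0 F \in cc_g2 G.
  by rewrite memvZ// -(frame0_gen F) memv_line.
rewrite /exp_coords linearDl !linearDr /=.
rewrite (cc_br12 (sum_g1 _) (scale_g2 _)) (cc_br22 (scale_g2 _) (scale_g2 _)).
rewrite (cc_br_antisym (p.2 *: _)) (cc_br12 (sum_g1 _) (scale_g2 _)).
rewrite oppr0 !addr0 linear_sumr dotvE scaler_suml; apply: eq_bigr => j _.
rewrite linearZr_LR linear_sumlz /= mxE mulr_suml scaler_suml scaler_sumr.
apply: eq_bigr => i _; rewrite linearZl_LR /= bracket_mxE !scalerA.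
by congr (_ *: _); ring.
Qed.

Let log_coords_is_linear : linear (log_coords F).
Proof.
move=> a u v; rewrite /log_coords linearP; congr (_, _).
by apply/rowP => i; rewrite !mxE linearP.
Qed.

HB.instance Definition _ :=
  GRing.isLinear.Build R G (coords R n) _ (log_coords F) log_coords_is_linear.

Lemma exp_coordsK p : log_coords F (exp_coords F p) = p.
Proof.
rewrite /exp_coords /log_coords [RHS]surjective_pairing; congr (_, _).
  apply/rowP => i; rewrite mxE linearD linear_sum linearZ /=.
  rewrite coordi0 mulr0 addr0 (bigD1 i)//= big1 ?addr0 => [|j /negPf ji].
    by rewrite linearZ /= coordij eqxx mulr1.
  by rewrite linearZ /= coordij ji mulr0.
rewrite linearD linear_sum linearZ /= coord00 mulr1.
by rewrite big1 ?add0r// => i _; rewrite linearZ /= coord0i mulr0.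
Qed.

Lemma log_coords_frame0 : log_coords F (frame0 F) = (0, 1).
Proof.
rewrite /log_coords coord00; congr (_, _).
by apply/rowP => i; rewrite !mxE coordi0.
Qed.

Lemma group_mulE p q :
  group_mul F p q = (p.1 + q.1, p.2 + q.2 + 2^-1 * dotv (p.1 *m A) q.1).
Proof.
rewrite /group_mul /bch cc_br_exp_coords 2!linearD !linearZ /= !exp_coordsK.
rewrite log_coords_frame0; case: p q => [x z] [x' z']; congr (_, _) => /=.
  by rewrite !scaler0 addr0.
by rewrite /GRing.scale /= mulr1.
Qed.

Lemma left_invariantE w p :
  left_invariant F w p = (w.1, w.2 + 2^-1 * dotv (p.1 *m A) w.1).
Proof.
set v : coords R n := RHS.
have group_mul_line :
    (fun t : R => group_mul F p (t *: w)) = fun t => p + t *: v.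
  apply/funext => t; rewrite group_mulE; congr (_, _) => /=.
  by rewrite dotvZr /GRing.scale /=; ring.
rewrite /left_invariant derive1E group_mul_line; apply: derive_val.
have := is_deriveD (is_derive_cst p (0 : R) 1)
  (is_derive_scalel v (is_derive_id (0 : R) 1)).
by rewrite add0r scale1r.
Qed.

Definition momentum s : 'rV[R]_(n.*2) := s.2.1 + (s.2.2 / 2) *: (s.1.1 *m A).

Lemma hamiltonianE s : hamiltonian F s = 2^-1 * sqnorm (momentum s).
Proof.
rewrite /hamiltonian /sqnorm; congr (_ * _); apply: eq_bigr => i _.
congr (_ ^+ 2); rewrite /frame_field left_invariantE /pairing /= add0r -dotvE.
by rewrite !dotv_delta !mxE mulrA.
Qed.

Lemma hamiltonian_fieldE s :
  hamiltonian_field F s =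
  ((momentum s, 2^-1 * dotv (s.1.1 *m A) (momentum s)),
   ((s.2.2 / 2) *: (momentum s *m A), 0)).
Proof.
case: s => [[x z] [y l]]; rewrite /hamiltonian_field /gradient.
set h := momentum _; congr ((_, _), (_, _)) => /=.
- apply/rowP => i; rewrite mxE -dotv_delta; apply: derive_half_sqnorm => a.
  rewrite hamiltonianE /momentum /=; congr (_ * sqnorm _).
  by rewrite [a *: 0]mulr0 add0r -addrA addrC.
- rewrite -dotvZl dotvC; apply: derive_half_sqnorm => a.
  rewrite hamiltonianE /momentum /=; congr (_ * sqnorm _).
  rewrite scaler0 add0r -addrA scalerA -scalerDl; congr (_ + _ *: _).
  by rewrite /GRing.scale /=; ring.
- apply/rowP => i; rewrite mxE /= mxE.
  rewrite (derive_half_sqnorm (h := h) (e := (l / 2) *: (delta_mx 0 i *m A))).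
    rewrite dotvZr dotvC dotv_mulmx bracket_mx_skew mulmxN dotvC -dotv_delta.
    by rewrite dotvNl dotvZl mulrN opprK.
  move=> a; rewrite hamiltonianE /h /momentum /=; congr (_ * sqnorm _).
  rewrite mulmxDl scalerDr -scalemxAl scalerA (addrC _ (_ *: (x *m A))) addrA.
  by congr (_ + _); rewrite scalerA mulrC.
- rewrite (derive_half_sqnorm (h := h) (e := 0)) ?dotv0r ?oppr0// => a.
  by rewrite hamiltonianE /momentum /= !scaler0 add0r addr0.
Qed.

End CarnotCoordinates.

(** * The function g *)

Section Trigonometry.
Context {R : realType}.
Implicit Types x w : R.

Lemma sin_pi_int (q : int) : sin (pi * q%:~R) = 0 :> R.
Proof.
have sin_pi_nat (i : nat) : sin (pi * i%:R) = 0 :> R.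
  by rewrite mulr_natr -[pi *+ i]add0r (alternatingn (@sinDpi R)) sin0 mulr0.
case: q => i; first by rewrite -pmulrn sin_pi_nat.
by rewrite NegzE rmorphN /= mulrN sinN -pmulrn sin_pi_nat oppr0.
Qed.

Lemma sin_eq0_lt_pi x : `|x| < pi -> sin x = 0 -> x = 0.
Proof.
move=> xpi sx; apply: contrapT => /eqP x0.
have : 0 < sin `|x| by rewrite sin_gt0_pi// normr_gt0 x0.
by case: (ger0P x) => _; rewrite ?sinN sx ?oppr0 ltxx.
Qed.

Lemma sin_eq0P x : sin x = 0 <-> exists q : int, x = pi * q%:~R.
Proof.
split=> [sx|[q ->]]; last exact: sin_pi_int.
have pi0 : 0 < pi :> R by exact: pi_gt0.
exists (Num.floor (x / pi)); apply/eqP; rewrite -subr_eq0; apply/eqP.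
apply: sin_eq0_lt_pi; last by rewrite sinB sx sin_pi_int mul0r mulr0 subr0.
have /andP[] := floor_itv (x / pi).
rewrite ler_pdivlMr// ltr_pdivrMr// intrD mulrDl mul1r ![_ * pi]mulrC => qx xq.
by rewrite ger0_norm ?subr_ge0// ltrBlDl.
Qed.

Lemma sin_zeros_closed_discrete (a : R) :
  a != 0 -> closed_discrete [set x | sin (x * a) = 0].
Proof.
move=> a0; apply: (@separated_closed_discrete _ _ (pi / `|a|)).
  by rewrite divr_gt0 ?pi_gt0 ?normr_gt0.
move=> x y /= sx sy; rewrite ltr_pdivlMr ?normr_gt0// -normrM mulrBl => xy.
have sxy : sin (x * a - y * a) = 0 by rewrite sinB sx sy mul0r mulr0 subrr.
by apply: (mulIf a0); apply/eqP; rewrite -subr_eq0 (sin_eq0_lt_pi xy sxy).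
Qed.

Lemma sin_zeros_bigcup_closed_discrete (k : nat) (a : 'I_k -> R) :
  (forall j, a j != 0) ->
  closed_discrete [set x | exists j, sin (x * a j / 2) = 0].
Proof.
move=> a0; apply: (@sub_closed_discrete _ _
  (\bigcup_j [set x : R | sin (x * (a j / 2)) = 0])).
  by move=> x [j sj]; exists j => //=; rewrite mulrA.
apply: closed_discrete_bigcup => j; apply: sin_zeros_closed_discrete.
by rewrite mulf_neq0 ?invr_neq0 ?pnatr_eq0.
Qed.

Lemma onem_cos_half x : 1 - cos x = 2 * sin (x / 2) ^+ 2.
Proof.
have {1}-> : x = (x / 2) *+ 2 by rewrite -mulr_natr mulfVK.
by rewrite cos_mulr2n cos2sin2 -mulr_natr; ring.
Qed.

Lemma sin_half x : sin x = 2 * sin (x / 2) * cos (x / 2).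
Proof.
have {1}-> : x = (x / 2) *+ 2 by rewrite -mulr_natr mulfVK.
by rewrite sin_mulr2n -mulr_natr; ring.
Qed.

Lemma sin_le_id x : 0 < x -> sin x <= x.
Proof.
move=> x0.
have [c _] := @MVT_is_derive _ sin cos 0 x x0 (fun y _ => is_derive_sin y).
rewrite sin0 !subr0 => ->; rewrite ler_piMl ?cos_le1//; exact: ltW.
Qed.

Lemma mul_cos_lt_sin x : 0 < x <= pi -> x * cos x < sin x.
Proof.
apply: (@ltr_is_derive _ (fun y => y * cos y) (fun y => cos y - y * sin y)
  sin cos).
- by rewrite mul0r sin0.
- by move=> y; apply: is_derive_eq; rewrite /GRing.scale /=; ring.
- move=> y /[dup] y_pi /andP[y0 _].
  by rewrite gtrBl mulr_gt0// sin_gt0_pi.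
Qed.

Lemma mul_sin_lt_cos x : 0 < x <= pi -> x * sin x < 2 * (1 - cos x).
Proof.
apply: (@ltr_is_derive _ (fun y => y * sin y) (fun y => sin y + y * cos y)
  (fun y => 2 * (1 - cos y)) (fun y => 2 * sin y)).
- by rewrite cos0 mul0r subrr mulr0.
- by move=> y; apply: is_derive_eq; rewrite /GRing.scale /=; ring.
- by move=> y; apply: is_derive_eq; rewrite /GRing.scale /=; ring.
- move=> y /andP[y0 ypi]; have := @mul_cos_lt_sin y; rewrite y0 ltW//.
  by move=> /(_ isT); lra.
Qed.

Lemma cusa_huygens x : 0 < x -> 3 * sin x < x * (2 + cos x).
Proof.
move=> x0; have := cos_geN1 x; have := sin_le1 x; have := @pi_ge2 R.
have [xpi _ _ _|pix pi2 s1 c1] := leP x pi.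
  apply: (@ltr_is_derive _ (fun y => 3 * sin y) (fun y => 3 * cos y)
    (fun y => y * (2 + cos y)) (fun y => 2 + cos y - y * sin y) pi).
  - by rewrite sin0 mulr0 mul0r.
  - by move=> y; apply: is_derive_eq; rewrite /GRing.scale /=; ring.
  - move=> y /andP[y0 ypi]; have := @mul_sin_lt_cos y; rewrite y0 ltW//.
    by move=> /(_ isT); lra.
  - by rewrite x0.
have [x2pi|x2pi] := leP x (2 * pi).
  have s0 : sin x <= 0.
    rewrite -oppr_ge0 -mulrN1; have := @sin_ge0_pi R (x - pi).
    by rewrite sinB sinpi cospi mulr0 subr0; apply; lra.
  by apply: (@le_lt_trans _ _ 0); [lra|rewrite mulr_gt0//; lra].
have : x * 1 <= x * (2 + cos x) by rewrite ler_pM2l//; lra.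
by lra.
Qed.

End Trigonometry.

Section GFunction.
Context {R : realType}.
Implicit Types w : R.

(* g off its poles; at a pole, x / 0 = 0 gives the junk value 0. *)
Definition g_real w : R := 8^-1 * ((w - sin w) / sin (w / 2) ^+ 2).

Definition dg_real w : R :=
  (2 * (1 - cos w) - w * sin w) / (4 * (1 - cos w) ^+ 2).

Definition d2g_real w : R :=
  (w * (2 + cos w) - 3 * sin w) / (4 * (1 - cos w) ^+ 2).

Lemma g_realN w : g_real (- w) = - g_real w.
Proof. by rewrite /g_real sinN mulNr sinN sqrrN; ring. Qed.

Lemma g_real_ge0 w : 0 < w -> 0 <= g_real w.
Proof.
move=> w0; rewrite /g_real mulr_ge0// divr_ge0 ?sqr_ge0// subr_ge0.
exact: sin_le_id.
Qed.

Lemma g_real_ge w : 0 < w -> sin (w / 2) != 0 -> (w - 1) / 8 <= g_real w.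
Proof.
move=> w0 sw; rewrite /g_real mulrC ler_pM2l ?invr_gt0//.
have s2_gt0 : 0 < sin (w / 2) ^+ 2 by rewrite exprn_even_gt0.
have s2_le1 : sin (w / 2) ^+ 2 <= 1.
  by have := cos2Dsin2 (w / 2); have := sqr_ge0 (cos (w / 2)); lra.
have := sin_le1 w; have := sin_le_id w0; rewrite ler_pdivlMr// => sw_w sw_1.
have : 0 <= (w - sin w) * (1 - sin (w / 2) ^+ 2) by rewrite mulr_ge0//; lra.
have : 0 <= (1 - sin w) * sin (w / 2) ^+ 2 by rewrite mulr_ge0//; lra.
by lra.
Qed.

Let onem_cos_neq0 w : sin (w / 2) != 0 -> 1 - cos w != 0.
Proof. by move=> sw; rewrite onem_cos_half mulf_neq0 ?sqrf_eq0 ?pnatr_eq0. Qed.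

Lemma is_derive_g_real w :
  sin (w / 2) != 0 -> is_derive w 1 g_real (dg_real w).
Proof.
move=> /onem_cos_neq0 cw.
have -> : g_real = fun w => (w - sin w) / (4 * (1 - cos w)).
  apply/funext => x; rewrite /g_real onem_cos_half; set s := sin (x / 2) ^+ 2.
  by have [->|s0] := eqVneq s 0; [rewrite !mulr0 invr0 !mulr0|field].
have num_der : is_derive w 1 (fun w : R => w - sin w) (1 - cos w).
  by apply: is_derive_eq.
have den_der : is_derive w 1 (fun w : R => 4 * (1 - cos w)) (4 * sin w).
  by apply: is_derive_eq; rewrite /GRing.scale /=; ring.
apply: is_derive_eq (is_derive_div _ num_der den_der) _.
  by rewrite mulf_neq0// pnatr_eq0.
have -> : (1 - cos w) * (4 * (1 - cos w)) - (w - sin w) * (4 * sin w) =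
    4 * (2 * (1 - cos w) - w * sin w).
  by have := cos2Dsin2 w; lra.
by rewrite /dg_real; field.
Qed.

Lemma is_derive_dg_real w :
  sin (w / 2) != 0 -> is_derive w 1 dg_real (d2g_real w).
Proof.
move=> /onem_cos_neq0 cw.
have num_der : is_derive w 1 (fun w : R => 2 * (1 - cos w) - w * sin w)
    (sin w - w * cos w).
  by apply: is_derive_eq; rewrite /GRing.scale /=; ring.
have den_der : is_derive w 1 (fun w : R => 4 * (1 - cos w) ^+ 2)
    (8 * (1 - cos w) * sin w).
  by apply: is_derive_eq; rewrite /GRing.scale /=; ring.
apply: is_derive_eq (is_derive_div _ num_der den_der) _.
  by rewrite mulf_neq0 ?pnatr_eq0// sqrf_eq0.
have -> : (sin w - w * cos w) * (4 * (1 - cos w) ^+ 2) -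
    (2 * (1 - cos w) - w * sin w) * (8 * (1 - cos w) * sin w) =
    (1 - cos w) * 4 * ((sin w - w * cos w) * (1 - cos w) -
    4 * (1 - cos w) * sin w + 2 * w * sin w ^+ 2) by ring.
have -> : sin w ^+ 2 = (1 - cos w) * (1 + cos w) by rewrite sin2cos2; ring.
by rewrite /d2g_real; field.
Qed.

Lemma d2g_real_gt0 w : 0 < w -> sin (w / 2) != 0 -> 0 < d2g_real w.
Proof.
move=> w0 /onem_cos_neq0 cw; rewrite divr_gt0 ?subr_gt0 ?cusa_huygens//.
by rewrite mulr_gt0// exprn_even_gt0.
Qed.

End GFunction.

Lemma finite_set_no_chain3 (disp : Order.disp_t) (T : orderType disp)
    (S : set T) :
  (forall a b c, S a -> S b -> S c -> (a < b)%O -> (b < c)%O -> False) ->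
  finite_set S.
Proof.
move=> no_chain; apply: contrapT => /(infinite_set_fset 3)[B BS B3].
pose s := sort <=%O (enum_fset B).
have : sorted <%O s by rewrite sort_lt_sorted fset_uniq.
have sS x : x \in s -> S x by rewrite mem_sort; exact: BS.
have : (3 <= size s)%N by rewrite size_sort.
case: s sS => [|a [|b [|c s]]] //= sS _ /and3P[ab bc _].
by apply: (no_chain a b c) => //; apply: sS; rewrite !inE eqxx ?orbT.
Qed.

Section GSum.
Context {R : realType} {k : nat} (a c : 'I_k -> R).
Implicit Types (l z : R) (j : 'I_k).

Definition g_sum l : R := \sum_j c j * g_real (l * a j).

Definition g_sum_pole : set R :=
  [set l | exists2 j, c j != 0 & sin (l * a j / 2) = 0].

Lemma g_sumN l : g_sum (- l) = - g_sum l.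
Proof.
by rewrite /g_sum -sumrN; apply: eq_bigr => j _; rewrite mulNr g_realN mulrN.
Qed.

Lemma g_sum_poleN l : g_sum_pole (- l) <-> g_sum_pole l.
Proof.
have poleN x : g_sum_pole x -> g_sum_pole (- x).
  by move=> [j cj sj]; exists j => //; rewrite !mulNr sinN sj oppr0.
by split=> [/poleN|/poleN//]; rewrite opprK.
Qed.

Lemma is_derive_sum_dilation (f f' : R -> R) (e : 'I_k -> R) l :
  (forall j, e j != 0 -> is_derive (l * a j) 1 f (f' (l * a j))) ->
  is_derive l 1 (fun s => \sum_j e j * f (s * a j))
    (\sum_j e j * a j * f' (l * a j)).
Proof.
move=> f_der; apply: is_derive_sumr => j.
have [->|ej] := eqVneq (e j) 0.
  by under eq_fun do rewrite mul0r; rewrite !mul0r; exact: is_derive_cst.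
have dil_der : is_derive l 1 (fun s : R => s * a j) (a j).
  by apply: is_derive_eq; rewrite /GRing.scale /= mulr1 ?mulr0 ?add0r.
have comp_der : is_derive l 1 (f \o (fun s => s * a j)) (f' (l * a j) * a j).
  by apply: is_derive1_comp; exact: f_der.
apply: is_derive_eq (is_deriveZ (e j) comp_der) _.
by rewrite /GRing.scale /=; ring.
Qed.

Hypothesis a_gt0 : forall j, 0 < a j.
Hypothesis c_ge0 : forall j, 0 <= c j.

Lemma g_sum_pole_closed_discrete : closed_discrete g_sum_pole.
Proof.
apply: (sub_closed_discrete _ (sin_zeros_bigcup_closed_discrete (a := a) _)).
  by move=> l [j _ sj]; exists j.
by move=> j; rewrite gt_eqF.
Qed.

Variable j0 : 'I_k.
Hypothesis cj0_gt0 : 0 < c j0.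

Lemma g_sum_no_three_equal_values x y z : 0 < x -> x < y -> y < z ->
  (forall l, x <= l <= z -> ~ g_sum_pole l) ->
  g_sum x = g_sum y -> g_sum y = g_sum z -> False.
Proof.
move=> x0 xy yz no_pole.
have sin_neq0 l j : x <= l <= z -> c j != 0 -> sin (l * a j / 2) != 0.
  by move=> xlz cj; apply/eqP => sj; apply: (no_pole l xlz); exists j.
apply: (@convex_no_three_equal_values _ g_sum
  (fun l => \sum_j c j * a j * dg_real (l * a j))
  (fun l => \sum_j c j * a j * a j * d2g_real (l * a j)) x y z xy yz) => l xlz.
- apply: is_derive_sum_dilation => j cj; apply: is_derive_g_real.
  exact: sin_neq0.
- apply: is_derive_sum_dilation => j; rewrite mulf_eq0 => /norP[cj _].
  by apply: is_derive_dg_real; exact: sin_neq0.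
have l0 : 0 < l by case/andP: xlz => xl _; exact: lt_le_trans xl.
have term_gt0 j : c j != 0 -> 0 < c j * a j * a j * d2g_real (l * a j).
  move=> cj; have cj_gt0 : 0 < c j by rewrite lt_neqAle eq_sym cj c_ge0.
  apply: mulr_gt0; first by rewrite !mulr_gt0.
  by apply: d2g_real_gt0; [exact: mulr_gt0|exact: sin_neq0].
rewrite (bigD1 j0)//= ltr_pwDl ?term_gt0 ?gt_eqF// sumr_ge0// => j _.
by have [->|/term_gt0/ltW//] := eqVneq (c j) 0; rewrite !mul0r.
Qed.

Lemma le_g_sum_sol l z : 0 < l -> ~ g_sum_pole l -> g_sum l = z ->
  l <= (8 * z / c j0 + 1) / a j0.
Proof.
move=> l0 no_pole gl.
have le_z : c j0 * g_real (l * a j0) <= z.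
  rewrite -gl /g_sum (bigD1 j0)//= lerDl sumr_ge0// => j _.
  by rewrite mulr_ge0// g_real_ge0// mulr_gt0.
have sin_neq0 : sin (l * a j0 / 2) != 0.
  by apply/eqP => sj; apply: no_pole; exists j0; rewrite ?gt_eqF.
have := g_real_ge (mulr_gt0 l0 (a_gt0 j0)) sin_neq0.
rewrite -(ler_pM2l cj0_gt0) => /le_trans /(_ le_z).
rewrite ler_pdivlMr// -lerBlDr ler_pdivlMr//; lra.
Qed.

Definition g_sum_sol z : set R := [set l | ~ g_sum_pole l /\ g_sum l = z].

Let finite_pole_free_sol (b e z : R) :
  (forall l, b < l < e -> ~ g_sum_pole l) ->
  finite_set [set l | [/\ b < l < e, 0 < l & g_sum l = z]].
Proof.
move=> no_pole; apply: finite_set_no_chain3.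
move=> x y t [/andP[bx _] x0 gx] [_ _ gy] [/andP[_ te] _ gt] xy yt.
apply: (g_sum_no_three_equal_values x0 xy yt) => [l /andP[xl lt]||];
  rewrite ?gx ?gy ?gt//.
by apply: no_pole; rewrite (lt_le_trans bx xl) (le_lt_trans lt te).
Qed.

(* The poles being discrete, an accumulation point of solutions would have a
   punctured neighborhood made of two pole-free intervals, each of which
   contains at most two solutions by strict convexity. *)
Lemma finite_g_sum_sol_gt0 z : finite_set (g_sum_sol z `&` [set l | 0 < l]).
Proof.
set S := _ `&` _; apply: contrapT => infS.
have bndS : bounded_set S.
  exists ((8 * z / c j0 + 1) / a j0); split=> [|M ltM l [[no_pole gl] l0]].
    exact: num_real.
  by rewrite /= gtr0_norm// (le_trans _ (ltW ltM))// le_g_sum_sol.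
have [x /limit_point_infinite_setP xS] :=
  infinite_bounded_limit_point_nonempty infS bndS.
have /nbhs_ballP[e /= e0 xe] := g_sum_pole_closed_discrete x.
apply: (xS (ball x e)); first exact: nbhsx_ballx.
have left_free l : x - e < l < x -> ~ g_sum_pole l.
  move=> /andP[el lx] /xe lE; have := lx; rewrite lE ?ltxx//.
  by rewrite /ball/= gtr0_norm ?subr_gt0// ltrBlDl -ltrBlDr.
have right_free l : x < l < x + e -> ~ g_sum_pole l.
  move=> /andP[xl le] /xe lE; have := xl; rewrite lE ?ltxx//.
  by rewrite /ball/= ltr0_norm ?subr_lt0// opprB ltrBlDl.
have fin_left := finite_pole_free_sol z left_free.
have fin_right := finite_pole_free_sol z right_free.
apply: sub_finite_set (_ : finite_set (_ `|` [set x] `|` _)); last first.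
  by rewrite !finite_setU; split; [split; [exact: fin_left|]|exact: fin_right].
move=> l []; rewrite /ball/= ltr_norml => /andP[lex xle] [[_ gl] l0].
case: (ltgtP l x) => [_|_|->]; last by left; right.
- by left; left; split=> //; rewrite andbT; lra.
- by right; split=> //=; lra.
Qed.

Lemma finite_g_sum_sol z : finite_set (g_sum_sol z `&` [set l | l != 0]).
Proof.
apply: (@sub_finite_set _ _ ((g_sum_sol z `&` [set l | 0 < l]) `|`
    -%R @` (g_sum_sol (- z) `&` [set l | 0 < l]))).
  move=> l [[no_pole gl] l0].
  case: (ltgtP l 0) (l0 : l != 0) => // [ln|lp] _; last by left.
  right; exists (- l); last exact: opprK.
  split; last by rewrite /= oppr_gt0.
  by split; [move/g_sum_poleN|rewrite g_sumN gl].
rewrite finite_setU; split; first exact: finite_g_sum_sol_gt0.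
by apply: finite_image; exact: finite_g_sum_sol_gt0.
Qed.

End GSum.

(** * The exponential map *)

Section HamiltonianFlow.
Context {R : realType} {n : nat} {G : contact_carnot R n}.
Variable F : adapted_frame G.
Local Notation A := (bracket_mx F).
Implicit Types (c : R -> coords R n * coords R n) (t : R).

Let A_skew := bracket_mx_skew F.

Lemma hamiltonian_curveP c : hamiltonian_curve F c -> forall t,
  [/\ is_derive t 1 (fun s => (c s).1.1) (momentum F (c t)),
      is_derive t 1 (fun s => (c s).1.2)
        (2^-1 * dotv ((c t).1.1 *m A) (momentum F (c t))),
      is_derive t 1 (fun s => (c s).2.1)
        (((c t).2.2 / 2) *: (momentum F (c t) *m A)) &
      is_derive t 1 (fun s => (c s).2.2) 0].
Proof.
move=> c_curve t; have := c_curve t; rewrite hamiltonian_fieldE => c_der.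
have point_der := is_derive_fst c_der; have covector_der := is_derive_snd c_der.
split.
- exact: is_derive_fst point_der.
- exact: is_derive_snd point_der.
- exact: is_derive_fst covector_der.
- exact: is_derive_snd covector_der.
Qed.

Lemma hamiltonian_curve_lambda c t :
  hamiltonian_curve F c -> (c t).2.2 = (c 0).2.2.
Proof.
move=> c_curve; apply: (@is_derive_0_is_cst _ (fun s => (c s).2.2)) => s.
by case: (hamiltonian_curveP c_curve s).
Qed.

Lemma is_derive_momentum c t : hamiltonian_curve F c ->
  is_derive t 1 (fun s => momentum F (c s))
    ((c 0).2.2 *: (momentum F (c t) *m A)).
Proof.
move=> c_curve; have [x_der _ y_der _] := hamiltonian_curveP c_curve t.
have := is_deriveD y_der (is_deriveZ ((c 0).2.2 / 2) (is_derive_mulmx A x_der)).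
rewrite (hamiltonian_curve_lambda t c_curve) -scalerDl -splitr.
rewrite [X in is_derive _ _ X _ -> _](_ : _ = fun s => momentum F (c s))//.
by apply/funext => s; rewrite /momentum (hamiltonian_curve_lambda s c_curve).
Qed.

Lemma hamiltonian_curve_unique c1 c2 :
  hamiltonian_curve F c1 -> hamiltonian_curve F c2 -> c1 0 = c2 0 -> c1 = c2.
Proof.
move=> c1_curve c2_curve c0; apply/funext => t.
have lambdaE s : (c1 s).2.2 = (c2 s).2.2.
  rewrite (hamiltonian_curve_lambda s c1_curve) c0.
  by rewrite (hamiltonian_curve_lambda s c2_curve).
have momentumE s : momentum F (c1 s) = momentum F (c2 s).
  pose D r := momentum F (c1 r) - momentum F (c2 r).
  have D_der (r : R) : is_derive r 1 D ((c1 0).2.2 *: (D r *m A)).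
    have := is_deriveB (is_derive_momentum r c1_curve)
      (is_derive_momentum r c2_curve).
    by rewrite c0 -scalerBr -mulmxBl.
  apply/eqP; rewrite -subr_eq0 -/(D s) -sqnorm_eq0.
  by rewrite (skew_flow_sqnorm s A_skew D_der) /D c0 subrr sqnorm0.
have xE : (fun s => (c1 s).1.1) =1 fun s => (c2 s).1.1.
  apply: (eq_is_derive_rV (df := fun s => momentum F (c1 s))) => [s|s|].
  - by case: (hamiltonian_curveP c1_curve s).
  - by rewrite momentumE; case: (hamiltonian_curveP c2_curve s).
  - by rewrite c0.
have zE : (fun s => (c1 s).1.2) =1 fun s => (c2 s).1.2.
  apply: (eq_is_derive (df := fun s =>
    2^-1 * dotv ((c1 s).1.1 *m A) (momentum F (c1 s)))) => [s|s|].
  - by case: (hamiltonian_curveP c1_curve s).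
  - by rewrite momentumE xE; case: (hamiltonian_curveP c2_curve s).
  - by rewrite c0.
have yE : (c1 t).2.1 = (c2 t).2.1.
  by have := momentumE t; rewrite /momentum lambdaE xE => /addIr.
rewrite [c1 t]surjective_pairing [c2 t]surjective_pairing.
rewrite [(c1 t).1]surjective_pairing [(c1 t).2]surjective_pairing.
by rewrite xE zE yE lambdaE -!surjective_pairing.
Qed.

Lemma lift_ofE c eta :
  hamiltonian_curve F c -> c 0 = (0, eta) -> lift_of F eta = c.
Proof.
move=> c_curve c0; apply: xget_unique => // c' [c_curve' c'0].
by apply: hamiltonian_curve_unique => //; rewrite c0.
Qed.

Lemma J_sqnorm c eta : hamiltonian_curve F c -> c 0 = (0, eta) ->
  J F eta = 2^-1 * sqnorm eta.1.
Proof.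
move=> c_curve c0; rewrite /J /energy /geodesic (lift_ofE c_curve c0).
congr (_ * _).
have speedE : (fun t => sqnorm (derive1 (fun s => (c s).1) t).1) =
    cst (sqnorm eta.1).
  apply/funext => t; rewrite derive1E; have c1_der := is_derive_fst (c_curve t).
  rewrite derive_val hamiltonian_fieldE /=.
  have momentum_der s := is_derive_momentum s c_curve.
  rewrite (skew_flow_sqnorm t A_skew momentum_der) c0 /momentum /=.
  by rewrite mul0mx scaler0 addr0.
rewrite speedE Rintegral_cst//= lebesgue_measure_itv/= lte_fin ltr01.
by rewrite -EFinD subr0 /= mulr1.
Qed.

Section FromMomentum.
Variables (x h : R -> 'rV[R]_(n.*2)) (z : R -> R).
Variables (u : 'rV[R]_(n.*2)) (l : R).
Hypothesis x_mulA : forall t, l *: (x t *m A) = h t - u.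
Hypothesis x_der : forall t, is_derive t 1 x (h t).
Hypothesis h_der : forall t, is_derive t 1 h (l *: (h t *m A)).
Hypothesis z_der :
  forall t, is_derive t 1 z (2^-1 * dotv (x t *m A) (h t)).
Hypothesis x0 : x 0 = 0.
Hypothesis z0 : z 0 = 0.

Definition momentum_lift t : coords R n * coords R n :=
  ((x t, z t), (u + 2^-1 *: (h t - u), l)).

Lemma hamiltonian_momentum_lift : hamiltonian_curve F momentum_lift.
Proof.
move=> t; rewrite hamiltonian_fieldE /=.
have -> : momentum F (momentum_lift t) = h t.
  rewrite /momentum /= mulrC -scalerA x_mulA -addrA -scalerDl.
  by rewrite (_ : 2^-1 + 2^-1 = 1) ?scale1r ?[u + _]addrC ?subrK//; lra.
do 2 apply: is_derive_pair => //.
have := is_deriveD (is_derive_cst u t 1)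
  (is_deriveZ 2^-1 (is_deriveB (h_der t) (is_derive_cst u t 1))).
by rewrite add0r subr0 scalerA mulrC.
Qed.

Lemma momentum_lift0 : momentum_lift 0 = (0, (u, l)).
Proof.
by rewrite /momentum_lift -x_mulA x0 z0 mul0mx !scaler0 addr0.
Qed.

Lemma exponential_map_momentum_lift : exponential_map F (u, l) = (x 1, z 1).
Proof.
rewrite /exponential_map /geodesic.
by rewrite (lift_ofE hamiltonian_momentum_lift momentum_lift0).
Qed.

Lemma J_momentum_lift : J F (u, l) = 2^-1 * sqnorm u.
Proof. exact: J_sqnorm hamiltonian_momentum_lift momentum_lift0. Qed.

End FromMomentum.

Section StraightLine.
Variable u : 'rV[R]_(n.*2).

Let line_mulA t : 0 *: ((t *: u) *m A) = u - u.
Proof. by rewrite scale0r subrr. Qed.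

Let line_der t : is_derive t 1 (fun s : R => s *: u) u.
Proof.
by rewrite -[X in is_derive _ _ _ X]scale1r; exact: is_derive_scalel.
Qed.

Let cst_der t : is_derive t 1 (fun=> u) (0 *: (u *m A)).
Proof. by rewrite scale0r; exact: is_derive_cst. Qed.

Let area_der t : is_derive t 1 (fun=> 0) (2^-1 * dotv ((t *: u) *m A) u).
Proof.
rewrite -scalemxAl dotvZl dotvC dotv_skew// !mulr0; exact: is_derive_cst.
Qed.

Lemma exponential_map_eq0 : exponential_map F (u, 0) = (u, 0).
Proof.
rewrite -[in RHS](scale1r u).
exact: (exponential_map_momentum_lift line_mulA line_der cst_der area_der
  (scale0r u)).
Qed.

Lemma J_eq0 : J F (u, 0) = 2^-1 * sqnorm u.
Proof.
exact: (J_momentum_lift line_mulA line_der cst_der area_der (scale0r u)).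
Qed.

End StraightLine.

End HamiltonianFlow.

Section ExponentialMap.
Context {R : realType} {n : nat} {G : contact_carnot R n}.
Variables (F : adapted_frame G) (k : nat) (alpha : 'I_k -> R) (m : 'I_k -> nat).
Hypothesis Halpha : distinct_singular_values (bracket_mx F) alpha m.
Local Notation A := (bracket_mx F).
Local Notation P := (spec_proj A alpha).
Implicit Types (u : 'rV[R]_(n.*2)) (l t : R).

Let A_skew := bracket_mx_skew F.
Let alpha_neq0 j : alpha j != 0.
Proof. by rewrite gt_eqF// (dsv_pos Halpha). Qed.

Definition position u l t := u *m spec_mx A alpha
  (fun j => (l * alpha j)^-1 * sin (l * alpha j * t))
  (fun j => (l * alpha j)^-1 * (1 - cos (l * alpha j * t))).

Definition velocity u l t := u *m spec_mx A alpha
  (fun j => cos (l * alpha j * t)) (fun j => sin (l * alpha j * t)).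

Definition height u l t := \sum_j (2^-1 * l^-1 * sqnorm (u *m P j)) *
  (t - (l * alpha j)^-1 * sin (l * alpha j * t)).

Lemma position0 u l : position u l 0 = 0.
Proof.
rewrite /position /spec_mx big1 ?mulmx0// => j _.
by rewrite mulr0 sin0 cos0 subrr !mulr0 mul0r !scale0r addr0.
Qed.

Lemma height0 u l : height u l 0 = 0.
Proof.
by rewrite /height big1// => j _; rewrite mulr0 sin0 mulr0 subr0 mulr0.
Qed.

Lemma position_mulA u l t :
  l != 0 -> l *: (position u l t *m A) = velocity u l t - u.
Proof.
move=> l0; rewrite -[X in _ - X]mulmx1 -(spec_mx1 Halpha).
rewrite -mulmxBr spec_mxB /position -mulmxA (spec_mx_mulA A_skew Halpha).
rewrite scalemxAr spec_mxZ; congr (_ *m _).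
by apply: eq_spec_mx => j; field; rewrite l0 alpha_neq0.
Qed.

Lemma is_derive_position u l t :
  l != 0 -> is_derive t 1 (position u l) (velocity u l t).
Proof.
move=> l0; apply: is_derive_mul_spec_mx => j.
  apply: is_derive_eq (is_deriveZ _ (is_derive_sin_mul _ _)) _.
  by rewrite /GRing.scale /= mulKf// mulf_neq0.
have versin_der : is_derive t 1 (fun s => 1 - cos (l * alpha j * s))
    (l * alpha j * sin (l * alpha j * t)).
  have cos_der := is_derive_cos_mul (l * alpha j) t.
  by apply: is_derive_eq; ring.
apply: is_derive_eq (is_deriveZ _ versin_der) _.
by rewrite /GRing.scale /= mulKf// mulf_neq0.
Qed.

Lemma is_derive_velocity u l t :
  is_derive t 1 (velocity u l) (l *: (velocity u l t *m A)).
Proof.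
rewrite /velocity -mulmxA (spec_mx_mulA A_skew Halpha) scalemxAr spec_mxZ.
apply: is_derive_mul_spec_mx => j.
  by apply: is_derive_eq (is_derive_cos_mul _ _) _; ring.
by apply: is_derive_eq (is_derive_sin_mul _ _) _; ring.
Qed.

Lemma sqnorm_velocity u l t : sqnorm (velocity u l t) = sqnorm u.
Proof.
rewrite (sqnorm_mul_spec_mx A_skew Halpha) (sqnorm_spec Halpha u).
by apply: eq_bigr => j _; rewrite cos2Dsin2 mul1r.
Qed.

Lemma is_derive_height u l t : l != 0 ->
  is_derive t 1 (height u l)
    (2^-1 * dotv (position u l t *m A) (velocity u l t)).
Proof.
move=> l0.
have -> : 2^-1 * dotv (position u l t *m A) (velocity u l t) =
    \sum_j (2^-1 * l^-1 * sqnorm (u *m P j)) * (1 - cos (l * alpha j * t)).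
  have -> : position u l t *m A = l^-1 *: (velocity u l t - u).
    by rewrite -position_mulA// scalerA mulVf// scale1r.
  rewrite dotvZl dotvBl -sqnormE sqnorm_velocity.
  rewrite (dotv_mul_spec_mx A_skew Halpha) (sqnorm_spec Halpha u).
  rewrite mulrA -sumrB mulr_sumr; apply: eq_bigr => j _; ring.
apply: is_derive_sumr => j.
apply: is_derive_eq (is_deriveZ _ (is_deriveB (is_derive_id _ _)
  (is_deriveZ _ (is_derive_sin_mul _ _)))) _.
by rewrite /GRing.scale /= mulKf// mulf_neq0.
Qed.

Section NonzeroLambda.
Variables (u : 'rV[R]_(n.*2)) (l : R).
Hypothesis l0 : l != 0.

Let position_mulA_l t := position_mulA u t l0.
Let position_der t := is_derive_position u t l0.
Let velocity_der t := is_derive_velocity u l t.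
Let height_der t := is_derive_height u t l0.

Lemma exponential_map_neq0 :
  exponential_map F (u, l) = (position u l 1, height u l 1).
Proof.
exact: (exponential_map_momentum_lift position_mulA_l position_der
  velocity_der height_der (position0 u l) (height0 u l)).
Qed.

Lemma J_neq0 : J F (u, l) = 2^-1 * sqnorm u.
Proof.
exact: (J_momentum_lift position_mulA_l position_der velocity_der height_der
  (position0 u l) (height0 u l)).
Qed.

End NonzeroLambda.

Lemma JE (eta : coords R n) : J F eta = 2^-1 * sqnorm eta.1.
Proof.
by case: eta => u l; have [->|l0] := eqVneq l 0; [exact: J_eq0|exact: J_neq0].
Qed.

End ExponentialMap.

(** * The fibers of the exponential map *)

Section FiberOfExponentialMap.
Context {R : realType} {n : nat} {G : contact_carnot R n}.
Variables (F : adapted_frame G) (k : nat) (alpha : 'I_k -> R) (m : 'I_k -> nat).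
Hypothesis Halpha : distinct_singular_values (bracket_mx F) alpha m.
Variable p : coords R n.
Local Notation A := (bracket_mx F).
Local Notation P := (spec_proj A alpha).
Implicit Types (u x : 'rV[R]_(n.*2)) (l : R) (j : 'I_k).

Let A_skew := bracket_mx_skew F.
Let alpha_gt0 j : 0 < alpha j := dsv_pos Halpha j.
Let alpha_neq0 j : alpha j != 0.
Proof. by rewrite gt_eqF. Qed.

Let half_neq0 l j : l != 0 -> l * alpha j / 2 != 0.
Proof. by move=> l0; rewrite !mulf_neq0 ?invr_neq0 ?pnatr_eq0. Qed.

Lemma component_ofE j x : component_of F alpha j x = x *m P j.
Proof. by rewrite spec_proj.unlock. Qed.

Lemma mem_I0 j : (j \in I0 F alpha p.1) = (p.1 *m P j == 0).
Proof. by rewrite inE component_ofE. Qed.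

Lemma mem_L l j : (j \in L alpha l) = (l != 0) && (sin (l * alpha j / 2) == 0).
Proof.
have -> : (j \in L alpha l) = (l \in Lambda_ alpha j) by [].
apply/idP/andP => [/set_mem[l0 [q lE]]|[l0 /eqP /sin_eq0P[q lq]]].
  split=> //; apply/eqP/sin_eq0P; exists q; rewrite lE.
  by field; rewrite alpha_neq0.
apply/mem_set; split=> //; exists q.
have -> : l = (l * alpha j / 2) * (2 / alpha j) by field.
by rewrite lq; field; rewrite alpha_neq0.
Qed.

Lemma LambdaP l : Lambda alpha l <-> exists j, j \in L alpha l.
Proof.
by split=> [[j _ jl]|[j /set_mem jl]]; exists j => //; exact: mem_set.
Qed.

Lemma Lambda_neq0 l : Lambda alpha l -> l != 0.
Proof. by move/LambdaP => [j]; rewrite mem_L => /andP[]. Qed.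

Lemma Lambda_closed_discrete : closed_discrete (Lambda alpha).
Proof.
apply: (sub_closed_discrete _ (sin_zeros_bigcup_closed_discrete alpha_neq0)).
by move=> l /LambdaP[j]; rewrite mem_L => /andP[_ /eqP sj]; exists j.
Qed.

Definition resonant_proj l : 'M[R]_(n.*2) := \sum_(j in L alpha l) P j.

Local Notation Q := resonant_proj.

Lemma resonant_proj_idem l : Q l *m Q l = Q l.
Proof. exact: (sum_spec_projM Halpha). Qed.

Lemma resonant_proj_tr l : (Q l)^T = Q l.
Proof. exact: (sum_spec_proj_tr Halpha). Qed.

Lemma rank_resonant_proj l : \rank (Q l) = (N alpha m l).*2.
Proof. exact: (rank_sum_spec_proj Halpha). Qed.

Lemma sqnorm_resonant_proj u l :
  sqnorm (u *m Q l) = \sum_(j in L alpha l) sqnorm (u *m P j).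
Proof. exact: (sqnorm_mul_sum_spec_proj Halpha). Qed.

Lemma resonant_proj_eq0 l :
  p.1 *m Q l = 0 <-> forall j, j \in L alpha l -> j \in I0 F alpha p.1.
Proof.
split=> [/eqP|LI].
  rewrite -sqnorm_eq0 sqnorm_resonant_proj.
  rewrite psumr_eq0 => [/allP x0 j jL|j _]; last exact: sqnorm_ge0.
  by have := x0 j (mem_index_enum j); rewrite jL sqnorm_eq0 mem_I0.
rewrite /resonant_proj mulmx_sumr big1// => j /LI.
by rewrite mem_I0 => /eqP.
Qed.

(* With w = l alpha_j, the integral (e^(iw) - 1) / (iw) of e^(iwt) over [0, 1]
   is sin (w / 2) / (w / 2) e^(iw / 2). *)
Definition position_mx l : 'M[R]_(n.*2) := spec_polar A alpha
  (fun j => sin (l * alpha j / 2) / (l * alpha j / 2))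
  (fun j => l * alpha j / 2).

(* A pseudo-inverse: where sin (w / 2) = 0, division by 0 gives 0. *)
Definition position_pinvmx l : 'M[R]_(n.*2) := spec_polar A alpha
  (fun j => l * alpha j / 2 / sin (l * alpha j / 2))
  (fun j => - (l * alpha j / 2)).

Lemma position1 u l : l != 0 -> position F alpha u l 1 = u *m position_mx l.
Proof.
move=> l0; congr (_ *m _); apply: eq_spec_mx => j; rewrite mulr1.
  by rewrite sin_half; field; rewrite l0 alpha_neq0.
by rewrite onem_cos_half; field; rewrite l0 alpha_neq0.
Qed.

Let sin_resonant l j : j \in L alpha l -> sin (l * alpha j / 2) = 0.
Proof. by rewrite mem_L => /andP[_ /eqP]. Qed.

Lemma position_mxK l :
  l != 0 -> position_mx l *m position_pinvmx l = 1%:M - Q l.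
Proof.
move=> l0; apply: (mul_spec_polar_inv A_skew Halpha) => j;
  last by rewrite subrr.
rewrite mem_L l0 /=; case: eqP => [->|/eqP sj]; first by rewrite !mul0r.
by rewrite mulrA mulfVK ?half_neq0// divff.
Qed.

Lemma position_pinvmxK l :
  l != 0 -> position_pinvmx l *m position_mx l = 1%:M - Q l.
Proof.
move=> l0; apply: (mul_spec_polar_inv A_skew Halpha) => j;
  last by rewrite addNr.
rewrite mem_L l0 /=; case: eqP => [->|/eqP sj]; first by rewrite !mul0r mulr0.
by rewrite mulrA mulfVK// divff ?half_neq0.
Qed.

Lemma position_mx_resonant l : position_mx l *m Q l = 0.
Proof.
apply: (spec_polar_mul_sum A_skew Halpha) => j /sin_resonant ->.
by rewrite mul0r.
Qed.

Lemma resonant_position_mx l : Q l *m position_mx l = 0.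
Proof.
by apply: (sum_mul_spec_polar Halpha) => j /sin_resonant ->; rewrite mul0r.
Qed.

Lemma position_pinvmx_resonant l : position_pinvmx l *m Q l = 0.
Proof.
apply: (spec_polar_mul_sum A_skew Halpha) => j /sin_resonant ->.
by rewrite invr0 mulr0.
Qed.

Lemma position_mx_solve u x l : l != 0 -> u *m position_mx l = x <->
  x *m Q l = 0 /\ u - u *m Q l = x *m position_pinvmx l.
Proof.
move=> l0; split=> [<-|[xQ uE]].
  rewrite -!mulmxA position_mx_resonant mulmx0 position_mxK//.
  by rewrite mulmxBr mulmx1.
rewrite -(subrK (u *m Q l) u) mulmxDl -(mulmxA u) resonant_position_mx mulmx0.
by rewrite addr0 uE -mulmxA position_pinvmxK// mulmxBr mulmx1 xQ subr0.
Qed.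

Definition g_weight j : R := alpha j * sqnorm (p.1 *m P j).

Lemma g_weight_ge0 j : 0 <= g_weight j.
Proof. by rewrite mulr_ge0 ?sqnorm_ge0// ltW. Qed.

Lemma g_weight_eq0 j : (g_weight j == 0) = (j \in I0 F alpha p.1).
Proof. by rewrite mulf_eq0 (negPf (alpha_neq0 j)) /= sqnorm_eq0 mem_I0. Qed.

Local Notation gs := (g_sum alpha g_weight).

Lemma height1 u l : l != 0 -> u *m position_mx l = p.1 ->
  height F alpha u l 1 = 2^-1 * l^-1 * sqnorm (u *m Q l) + gs l.
Proof.
move=> l0 xE; rewrite sqnorm_resonant_proj mulr_sumr [X in X + _]big_mkcond.
rewrite -big_split /=; apply: eq_bigr => j _; rewrite mulr1.
rewrite /g_weight -xE (sqnorm_mul_spec_polar_proj A_skew Halpha) mem_L l0 /=.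
rewrite /g_real sin_half; case: eqP => [->|/eqP].
  by rewrite !(mulr0, mul0r, expr0n) subr0 mulr1 addr0.
set s := sin _; move: (cos _) => c s0.
by field; rewrite s0 l0 alpha_neq0.
Qed.

Definition sphere_center l : 'rV[R]_(n.*2) := p.1 *m position_pinvmx l.

Definition sphere_sqradius l : R := 2 * l * (p.2 - gs l).

Local Notation slice l :=
  (affine_sphere (Q l) (sphere_center l) (sphere_sqradius l)).

Lemma Gamma_neq0P u l :
  l != 0 -> Gamma F p (u, l) <-> p.1 *m Q l = 0 /\ slice l u.
Proof.
move=> l0.
have heightP s : 2^-1 * l^-1 * s + gs l = p.2 <-> s = sphere_sqradius l.
  by rewrite /sphere_sqradius; split=> [<-|->]; field.
rewrite /Gamma /= (exponential_map_neq0 Halpha)// position1//.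
split=> [pE|[xQ [uE sE]]].
  have xE : u *m position_mx l = p.1 by rewrite -pE.
  have /(position_mx_solve _ _ l0)[xQ uE] := xE.
  by split=> //; split=> //; apply/heightP; rewrite -height1// -pE.
have xE : u *m position_mx l = p.1 by apply/position_mx_solve.
by rewrite xE height1//; move/heightP : sE => ->; rewrite -surjective_pairing.
Qed.

Lemma Gamma_eq0P u : Gamma F p (u, 0) <-> p = (u, 0).
Proof. by rewrite /Gamma /= exponential_map_eq0; split=> ->. Qed.

Definition g_ereal_sum l : \bar R :=
  (\sum_(j < k | j \notin I0 F alpha p.1)
    (alpha j)%:E * g (l * alpha j)
      * (sqnorm (component_of F alpha j p.1))%:E)%E.

Lemma g_ereal_sumE l :
  l != 0 -> p.1 *m Q l = 0 -> g_ereal_sum l = (gs l)%:E.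
Proof.
move=> l0 /resonant_proj_eq0 LI; rewrite /g_ereal_sum /g_sum -sumEFin.
rewrite big_mkcond; apply: eq_bigr => j _; case: ifPn => [jI|]; last first.
  by rewrite negbK -g_weight_eq0 => /eqP ->; rewrite mul0r.
have sj : sin (l * alpha j / 2) != 0.
  by apply: contra jI => sj; apply: LI; rewrite mem_L l0.
rewrite /g mulf_eq0 (negPf l0) (negPf (alpha_neq0 j)) (negPf sj) -!EFinM.
by rewrite /g_weight /g_real component_ofE mulrAC.
Qed.

Let g_pole_term l j : j \in L alpha l -> j \notin I0 F alpha p.1 ->
  ((alpha j)%:E * g (l * alpha j) * (sqnorm (component_of F alpha j p.1))%:E =
   if (0 < l)%R then +oo else -oo)%E.
Proof.
rewrite mem_L mem_I0 component_ofE => /andP[l0 sj] xj.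
rewrite /g mulf_eq0 (negPf l0) (negPf (alpha_neq0 j)) /= sj pmulr_lgt0//.
have x_gt0 : 0 < sqnorm (p.1 *m P j) by rewrite sqnorm_gt0.
case: ifP => _.
  by rewrite gt0_muley ?lte_fin// gt0_mulye ?lte_fin.
by rewrite gt0_muleNy ?lte_fin// gt0_mulNye ?lte_fin.
Qed.

Lemma g_ereal_sum_pole l : l != 0 -> p.1 *m Q l <> 0 ->
  ((p.2%:E - g_ereal_sum l) * l%:E = -oo)%E.
Proof.
move=> l0 /resonant_proj_eq0/existsNP[i /not_implyP[iL /negP iI]].
have := g_pole_term iL iI.
case: (ltgtP l 0) (l0) => // [l_lt0|l_gt0] _ term_i.
  have -> : g_ereal_sum l = -oo%E by apply/esum_eqNyP; exists i.
  by rewrite /= addey// lt0_mulye// lte_fin.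
have -> : g_ereal_sum l = +oo%E.
  apply/esum_eqyP; last by exists i.
  move=> j jI; have [jL|jL] := boolP (j \in L alpha l).
    by rewrite g_pole_term// l_gt0.
  have sj : sin (l * alpha j / 2) != 0 by move: jL; rewrite mem_L l0.
  by rewrite /g mulf_eq0 (negPf l0) (negPf (alpha_neq0 j)) (negPf sj) -!EFinM.
by rewrite /= addeNy// gt0_mulNye// lte_fin.
Qed.

Lemma Lambda_pP l : Lambda_p F alpha p l <->
  [/\ Lambda alpha l, p.1 *m Q l = 0 & 0 < sphere_sqradius l].
Proof.
rewrite /Lambda_p /= -/(g_ereal_sum l).
have [Ll|nLl] := pselect (Lambda alpha l); last by split=> [[]|[]].
have l0 := Lambda_neq0 Ll; have [xQ|nxQ] := pselect (p.1 *m Q l = 0).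
  have -> : sphere_sqradius l = 2 * ((p.2 - gs l) * l).
    by rewrite /sphere_sqradius -mulrA (mulrC l).
  rewrite g_ereal_sumE// -EFinB -EFinM lte_fin [in X in _ <-> X]pmulr_rgt0//.
  by split=> [[_ r0]|[_ _ r0]]; split.
by rewrite g_ereal_sum_pole//; split=> [[]|[]].
Qed.

Lemma sum_I0_sqradius u l : l != 0 -> Gamma F p (u, l) ->
  \sum_(j in I0 F alpha p.1) sqnorm (component_of F alpha j u) =
  sphere_sqradius l.
Proof.
move=> l0 /(Gamma_neq0P _ l0)[/resonant_proj_eq0 LI [uE <-]].
rewrite sqnorm_resonant_proj big_mkcond [RHS]big_mkcond; apply: eq_bigr => j _.
rewrite component_ofE; have [jL|jL] := boolP (j \in L alpha l).
  by rewrite LI.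
case: ifP => //; rewrite mem_I0 => /eqP xj.
have := congr1 (mulmx^~ (P j)) uE; rewrite mulmxBl -!mulmxA.
rewrite (mul_sum_spec_proj Halpha) (negPf jL) mulmx0 subr0 => ->.
by rewrite (spec_mx_comm A_skew Halpha) mulmxA xj mul0mx sqnorm0.
Qed.

Lemma Gamma_infP u l :
  Gamma_inf F alpha p (u, l) <-> Lambda_p F alpha p l /\ slice l u.
Proof.
split=> [[Gu nG0]|[/Lambda_pP[Ll xQ r0] uS]]; last first.
  have l0 := Lambda_neq0 Ll; have Gu : Gamma F p (u, l) by apply/Gamma_neq0P.
  split=> // -[_ /=]; rewrite (sum_I0_sqradius l0 Gu) => /eqP.
  by rewrite gt_eqF.
have [l0|l0] := eqVneq l 0.
  exfalso; apply: nG0; split=> //; move: Gu; rewrite l0 => /Gamma_eq0P pE.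
  by rewrite big1// => j; rewrite pE /= => /eqP ->; exact: sqnorm0.
have r_neq0 : sphere_sqradius l != 0.
  by apply/eqP => r0; apply: nG0; split=> //=; rewrite (sum_I0_sqradius l0 Gu).
have /(Gamma_neq0P _ l0)[xQ uS] := Gu; split=> //; have [_ sE] := uS.
apply/Lambda_pP; split=> //; last first.
  by rewrite lt_neqAle eq_sym r_neq0 -sE sqnorm_ge0.
apply/LambdaP; apply: contrapT => nL; move: r_neq0.
by rewrite -sE sqnorm_resonant_proj big1 ?eqxx// => j jL; case: nL; exists j.
Qed.

Lemma sub_Gamma0 : Gamma0 F alpha p `<=` [set (p.1, 0)] `|`
  (fun l => (sphere_center l, l)) @`
    (g_sum_sol alpha g_weight p.2 `&` [set l | l != 0]).
Proof.
move=> [u l] [Gu /= s0]; have [l0|l0] := eqVneq l 0.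
  by left; move: Gu; rewrite l0 => /Gamma_eq0P ->.
right; rewrite (sum_I0_sqradius l0 Gu) in s0.
have /(Gamma_neq0P _ l0)[/resonant_proj_eq0 LI [uE]] := Gu.
rewrite s0 => /eqP; rewrite sqnorm_eq0 => /eqP uQ0; exists l; last first.
  by rewrite -uE uQ0 subr0.
split=> //; split=> [[j]|].
  by rewrite g_weight_eq0 => /negP nI sj; apply/nI/LI; rewrite mem_L l0 sj eqxx.
move/eqP: s0; rewrite !mulf_eq0 pnatr_eq0 (negPf l0) /= subr_eq0.
by move=> /eqP.
Qed.

Lemma finite_Gamma0 : p <> (0, 0) -> finite_set (Gamma0 F alpha p).
Proof.
move=> p0; have [[j jI]|nI] := pselect (exists j, j \notin I0 F alpha p.1).
  apply: sub_finite_set sub_Gamma0 _; rewrite finite_setU.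
  split; first exact: finite_set1.
  apply: finite_image; apply: (@finite_g_sum_sol _ _ _ _ _ _ j) => //.
    exact: g_weight_ge0.
  by rewrite lt_neqAle eq_sym g_weight_eq0 jI g_weight_ge0.
have I0T j : j \in I0 F alpha p.1.
  by apply: contrapT => /negP jI; apply: nI; exists j.
have x0 : p.1 = 0.
  by apply: (spec_ext Halpha) => j; rewrite mul0mx; apply/eqP; rewrite -mem_I0.
rewrite (_ : Gamma0 _ _ _ = set0); first exact: finite_set0.
rewrite -subset0 => -[u l] /[dup] -[Gu _] /sub_Gamma0[[_ l0]|[l' [[_ gz] _] _]].
  by move: Gu; rewrite l0 => /Gamma_eq0P pE; apply: p0; rewrite pE -x0 pE.
apply: p0; rewrite [p]surjective_pairing x0 -gz /g_sum big1// => j _.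
by have := I0T j; rewrite -g_weight_eq0 => /eqP ->; rewrite mul0r.
Qed.

Let Lambda_p_Lambda : Lambda_p F alpha p `<=` Lambda alpha.
Proof. by move=> l /Lambda_pP[]. Qed.

Let Lambda_p_closed_discrete : closed_discrete (Lambda_p F alpha p).
Proof. exact: sub_closed_discrete Lambda_p_Lambda Lambda_closed_discrete. Qed.

Let Gamma_inf_Lambda_p eta :
  Gamma_inf F alpha p eta -> Lambda_p F alpha p eta.2.
Proof. by case: eta => u l /Gamma_infP[]. Qed.

Let Gamma_inf_slice l : Lambda_p F alpha p l ->
  [set u | Gamma_inf F alpha p (u, l)] = slice l.
Proof.
move=> Ll; apply/seteqP; split=> u; first by move=> /Gamma_infP[].
by move=> uS; apply/Gamma_infP.
Qed.

Lemma closed_Gamma_inf : closed (Gamma_inf F alpha p).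
Proof.
apply: (closed_slices Lambda_p_closed_discrete Gamma_inf_Lambda_p) => l.
have [Ll|nLl] := pselect (Lambda_p F alpha p l).
  by rewrite Gamma_inf_slice//; exact: closed_affine_sphere.
rewrite (_ : [set u | _] = set0); first exact: closed0.
by rewrite -subset0 => u /Gamma_infP[].
Qed.

Lemma homeomorphic_Gamma_inf :
  homeomorphic (Gamma_inf F alpha p) (spheres F alpha m p).
Proof.
apply: (homeomorphic_slices Lambda_p_closed_discrete Gamma_inf_Lambda_p) => l.
have Ll : Lambda_p F alpha p (set_val l) by exact: (set_valP l).
rewrite Gamma_inf_slice// -rank_resonant_proj.
have /Lambda_pP[_ _ r_gt0] := Ll.
apply: homeomorphic_affine_sphere => //; first exact: resonant_proj_idem.
by rewrite /sphere_center -mulmxA position_pinvmx_resonant mulmx0.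
Qed.

Lemma Gamma_snd_closed_discrete :
  p <> (0, 0) -> closed_discrete (snd @` Gamma F p).
Proof.
move=> p0; apply: (@sub_closed_discrete _ _
  (snd @` Gamma0 F alpha p `|` Lambda_p F alpha p)).
  move=> _ [eta Geta <-]; have [G0|nG0] := pselect (Gamma0 F alpha p eta).
    by left; exists eta.
  by right; exact: Gamma_inf_Lambda_p.
apply: closed_discreteU => //; apply: finite_closed_discrete.
  exact/hausdorff_accessible/norm_hausdorff.
by apply: finite_image; exact: finite_Gamma0.
Qed.

Lemma J_Gamma u u' l :
  Gamma F p (u, l) -> Gamma F p (u', l) -> J F (u, l) = J F (u', l).
Proof.
rewrite !(JE Halpha) /=; have [->|l0] := eqVneq l 0.
  by move=> /Gamma_eq0P pE /Gamma_eq0P; rewrite pE => -[->].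
move=> /(Gamma_neq0P _ l0)[_ uS] /(Gamma_neq0P _ l0)[_ u'S]; congr (_ * _).
have sqnorm_slice v :
    slice l v -> sqnorm v = sqnorm (sphere_center l) + sphere_sqradius l.
  apply: sqnorm_affine_sphere; first exact: resonant_proj_idem.
  exact: resonant_proj_tr.
by rewrite (sqnorm_slice _ uS) (sqnorm_slice _ u'S).
Qed.

End FiberOfExponentialMap.

Lemma J_connected_component (R : realType) (n : nat) (G : contact_carnot R n)
    (F : adapted_frame G) (k : nat) (alpha : 'I_k -> R) (m : 'I_k -> nat)
    (p eta eta' : coords R n) :
  distinct_singular_values (bracket_mx F) alpha m -> p <> (0, 0) ->
  Gamma F p eta -> connected_component (Gamma F p) eta eta' ->
  J F eta = J F eta'.
Proof.
move=> Halpha p0 Geta Ceta'.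
have CG := @connected_component_sub _ (Gamma F p) eta.
have lambdaE : eta.2 = eta'.2.
  apply: (@connected_closed_discrete _
    (snd @` connected_component (Gamma F p) eta) (snd @` Gamma F p)).
  - exact/hausdorff_accessible/norm_hausdorff.
  - exact: (Gamma_snd_closed_discrete Halpha p0).
  - exact: image_subset CG.
  - apply: connected_continuous_connected; first exact: component_connected.
    by apply: continuous_subspaceT => x; exact: cvg_snd.
  - by exists eta => //; exact: connected_component_refl.
  - by exists eta'.
have := CG _ Ceta'; move: Geta lambdaE {Ceta' CG}.
by case: eta eta' => [u l] [u' l'] /= Gu <- Gu'; exact: (J_Gamma Halpha Gu Gu').
Qed.

Theorem theorem22 (R : realType) (n : nat) (G : contact_carnot R n)
    (F : adapted_frame G) (k : nat) (alpha : 'I_k -> R) (m : 'I_k -> nat)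
    (Halpha : distinct_singular_values (bracket_mx F) alpha m)
    (p : coords R n) (Hp : p <> (0, 0)) :
  [/\ finite_set (Gamma0 F alpha p),
      closed (Gamma_inf F alpha p),
      homeomorphic (Gamma_inf F alpha p) (spheres F alpha m p) &
      forall eta eta' : coords R n, Gamma F p eta ->
        connected_component (Gamma F p) eta eta' -> J F eta = J F eta'].
Proof.
split.
- exact: (finite_Gamma0 Halpha).
- exact: (closed_Gamma_inf Halpha).
- exact: (homeomorphic_Gamma_inf Halpha).
- by move=> eta eta'; exact: (J_connected_component Halpha Hp).
Qed.
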